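(* Let $\alpha\in(0,1)$ and $T>0$. Let $\xi$ be a real random variable on a probability space $(\Omega,\mathcal{F},\mathbb{P})$ such that its fractional characteristic function $\varphi_{\alpha,\alpha}^{(\xi)}(s)=\mathbb{E}(E_{\alpha,\alpha}(\mathrm{i}s\xi))$ vanishes at infinity, i.e. $\varphi_{\alpha,\alpha}^{(\xi)}(s)\to0$ as $|s|\to\infty$. Let $G\subset\mathbb{R}^d$ ($d\geq 1$) be a (bounded) Lipschitz domain and $G_0\subset G$ a measurable subset of positive Lebesgue measure. Then the system $$\partial^{\alpha}_{0,t}y-\xi\,\mathrm{i}\,\Delta y=\mathds{1}_{G_0}u\ \text{ in }(0,T)\times G,\qquad y=0\ \text{ on }(0,T)\times\partial G,\qquad y(0,\cdot)=y_0\ \text{ in }G,$$ is not exactly averaged controllable in $L^2(G)$ with controls acting in $L^\infty((0,T)\times G_0)$.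
   Context: $L^2(G)=L^2(G;\mathbb{C})$ with its Hermitian inner product $\langle\cdot,\cdot\rangle$. $\{\lambda_n\}_{n\in\mathbb{N}}$ (with $\mathbb N=\{0,1,2,\dots\}$) are the eigenvalues of the Dirichlet Laplacian $-\Delta$ on $G$, with $0<\lambda_0\le\lambda_1\le\cdots\to\infty$, and $\{e_n\}_{n\in\mathbb{N}}$ is a corresponding Hilbert basis of $L^2(G)$ of eigenfunctions. $\partial^{\alpha}_{0,t}y(t)=\frac{1}{\Gamma(1-\alpha)}\int_0^t(t-\tau)^{-\alpha}\partial_\tau y(\tau)\,\mathrm{d}\tau$ is the Caputo derivative. $\mathds{1}_{G_0}$ is the indicator function of $G_0$. $E_{\alpha,\beta}(z)=\sum_{n=0}^{\infty}\frac{z^n}{\Gamma(\alpha n+\beta)}$ is the Mittag--Leffler function. For each real value of $\xi$, the solution of the system is given by $$y(t,\cdot;\xi;y_0;u)=\sum_{n=0}^{\infty}\left[\langle y_0,e_n\rangle E_{\alpha,1}(-\mathrm{i}\xi\lambda_nt^\alpha)+\int_0^t\langle\mathds{1}_{G_0}u(s,\cdot),e_n\rangle(t-s)^{\alpha-1}E_{\alpha,\alpha}(-\mathrm{i}\xi\lambda_n(t-s)^\alpha)\,\mathrm{d}s\right]e_n ,$$ and $\mathbb{E}$ denotes expectation with respect to $\xi=\xi(\omega)$; the data $y_0$ and the control $u$ do not depend on $\omega$. Definition. The system is exactly averaged controllable in $L^2(G)$ (with control cost $\mathscr{C}_{ex}$) if there is a constant $\mathscr{C}_{ex}=\mathscr{C}_{ex}(G,G_0,\xi,T)>0$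 such that for all $y_0,y_1\in L^2(G)$ there exists a control $u\in L^\infty((0,T)\times G_0)$ with $\|u\|_{L^\infty((0,T)\times G_0)}\le\mathscr{C}_{ex}(\|y_0\|_{L^2(G)}+\|y_1\|_{L^2(G)})$ and $\mathbb{E}(y(T,\cdot;\xi;y_0;u))=y_1$. *)

(* Defs.v *)
From HB Require Import structures.
Set Warnings "-notation-overridden,-ambiguous-paths,-notation-incompatible-prefix,-redundant-canonical-projection".
From mathcomp Require Import all_boot all_order all_algebra.
From mathcomp Require Import all_classical all_reals all_analysis.
From mathcomp Require Import measurable_realfun.
From mathcomp Require Import complex lra.

Set Implicit Arguments.
Unset Strict Implicit.
Unset Printing Implicit Defensive.
Import Order.TTheory GRing.Theory Num.Theory.
Import numFieldNormedType.Exports.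
Import ComplexField.Normc.

Local Open Scope classical_set_scope.
Local Open Scope ring_scope.
Local Open Scope complex_scope.

Section lebesgue_outer_measure.
Context {R : realType} {d : nat}.
Implicit Types (I : 'rV[R]_d * 'rV[R]_d) (O : option ('rV[R]_d * 'rV[R]_d)).
Implicit Types A B : set 'rV[R]_d.

(* The pair (a, b) encodes the half-open box \prod_i ]a_i, b_i].              *)
Definition box I : set 'rV[R]_d :=
  [set x | forall i, I.1 0 i < x 0 i <= I.2 0 i].

Definition box_volume I : R := \prod_(i < d) Num.max 0 (I.2 0 i - I.1 0 i).

(* None stands for the empty set, so that finite covers are allowed (this     *)
(* matters only for d = 0, where no box is empty).                            *)
Definition obox O : set 'rV[R]_d := oapp box set0 O.

Definition obox_volume O : R := oapp box_volume 0 O.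

Definition box_cover A : set (nat -> option ('rV[R]_d * 'rV[R]_d)) :=
  [set F | A `<=` \bigcup_k obox (F k)].

Definition lebesgue_outer A : \bar R :=
  ereal_inf [set (\sum_(k <oo) (obox_volume (F k))%:E)%E | F in box_cover A].

Lemma box_volume_ge0 I : 0 <= box_volume I.
Proof. by apply: prodr_ge0 => i _; rewrite le_max lexx. Qed.

Lemma obox_volume_ge0 O : (0 <= (obox_volume O)%:E)%E.
Proof. by case: O => [I|] //=; rewrite lee_fin box_volume_ge0. Qed.

Lemma lebesgue_outer_ge0 A : (0 <= lebesgue_outer A)%E.
Proof.
apply: le_ereal_inf_tmp => _ [F _ <-].
by apply: nneseries_ge0 => n _ _; exact: obox_volume_ge0.
Qed.

Lemma le_lebesgue_outer : {homo lebesgue_outer : A B / A `<=` B >-> (A <= B)%E}.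
Proof.
move=> A B AB; apply/ereal_inf_le_tmp => x [F BF <-{x}].
by exists F => //; exact: subset_trans AB BF.
Qed.

Lemma lebesgue_outer_obox O : (lebesgue_outer (obox O) <= (obox_volume O)%:E)%E.
Proof.
apply: ereal_inf_lbound; exists (fun k => if k == 0%N then O else None).
  by move=> x xO; exists 0%N.
rewrite nneseries_recl//; last by move=> n _; exact: obox_volume_ge0.
by rewrite eseries_cond/= eseries0 ?adde0// => -[|].
Qed.

Lemma lebesgue_outer0 : lebesgue_outer set0 = 0%E.
Proof.
apply/eqP; rewrite eq_le lebesgue_outer_ge0 andbT.
exact: (lebesgue_outer_obox None).
Qed.

Lemma lebesgue_outer_sigma_subadditive : sigma_subadditive lebesgue_outer.
Proof.
move=> A; have [[i ioo]|] := pselect (exists i, lebesgue_outer (A i) = +oo%E).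
  rewrite (eseries_pinfty _ _ ioo) ?leey// => n _.
  by rewrite -ltNye (lt_le_trans _ (lebesgue_outer_ge0 _)).
rewrite -forallNE => Aoo.
suff add2e (e : {posnum R}) : (lebesgue_outer (\bigcup_n A n) <=
    \sum_(i <oo) lebesgue_outer (A i) + e%:num%:E)%E.
  by apply/lee_addgt0Pr => _/posnumP[].
rewrite (le_trans _ (epsilon_trick _ _ _))//; last first.
  by move=> n; exact: lebesgue_outer_ge0.
pose P n F := box_cover (A n) F /\ (\sum_(k <oo) (obox_volume (F k))%:E <=
  lebesgue_outer (A n) + (e%:num / (2 ^ n.+1)%:R)%:E)%E.
have [G PG] : {G : nat -> nat -> option ('rV[R]_d * 'rV[R]_d) &
    forall n, P n (G n)}.
  apply: (@choice _ _ P) => n; rewrite /P /lebesgue_outer.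
  set S := (X in ereal_inf X); move infS : (ereal_inf S) => iS.
  case: iS infS => [r Sr|Soo|Soo].
  - have en1 : 0 < e%:num / (2 ^ n.+1)%:R by [].
    have /(lb_ereal_inf_adherent en1) : ereal_inf S \is a fin_num by rewrite Sr.
    move=> [x [F AF Fx xS]].
    by exists F; split => //; rewrite Fx -Sr; exact/ltW.
  - by have := Aoo n; rewrite /lebesgue_outer Soo.
  - suff : lbound S 0%E by move/le_ereal_inf_tmp; rewrite Soo.
    by move=> /= _ [F _ <-]; apply: nneseries_ge0 => k _ _; exact: obox_volume_ge0.
pose v (ij : nat * nat) := (obox_volume (G ij.1 ij.2))%:E.
have v_ge0 ij : (0 <= v ij)%E by exact: obox_volume_ge0.
apply: (@le_trans _ _ (\esum_(ij in setT) v ij)).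
  apply: ereal_inf_lbound => /=.
  have /card_esym/ppcard_eqP[f] := card_nat2.
  exists (uncurry G \o f).
    move=> t [i _] /(PG i).1 [j _ Gijt]; exists (f^-1%FUN (i, j)) => //=.
    by rewrite invK ?inE.
  rewrite nneseries_esumT; last by move=> k; exact: obox_volume_ge0.
  rewrite (reindex_esum setT setT f)//.
  by apply: eq_esum => k _; rewrite /v/=; case: (f k).
rewrite [leLHS](_ : _ = \sum_(i <oo) \sum_(j <oo) v (i, j))%E; last first.
  rewrite nneseries_esumT; last first.
    by move=> i; apply: nneseries_ge0 => j _ _; exact: v_ge0.
  under [RHS]eq_esum do rewrite nneseries_esumT//.
  rewrite esum_esum//; congr esum.
  by apply/seteqP; split.
apply: lee_nneseries => [i _ _|i _]; last exact: (PG i).2.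
by apply: nneseries_ge0 => j _ _; exact: v_ge0.
Qed.

HB.instance Definition _ := isOuterMeasure.Build R 'rV[R]_d lebesgue_outer
  lebesgue_outer0 lebesgue_outer_ge0 le_lebesgue_outer
  lebesgue_outer_sigma_subadditive.

Lemma box_volumeD (a b : 'rV[R]_d) i (c : R) :
  box_volume (a, \row_j if j == i then Num.min (b 0 j) c else b 0 j) +
  box_volume (\row_j (if j == i then Num.max (a 0 j) c else a 0 j), b) =
  box_volume (a, b).
Proof.
rewrite /box_volume/= (bigD1 i)//= [X in _ + X](bigD1 i)//= [RHS](bigD1 i)//=.
rewrite !mxE eqxx.
set p := (X in _ = _ * X); rewrite -[X in _ * X + _](_ : p = _); last first.
  by apply: eq_bigr => j /negbTE ji; rewrite mxE ji.
rewrite -[X in _ + _ * X](_ : p = _); last first.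
  by apply: eq_bigr => j /negbTE ji; rewrite mxE ji.
rewrite -mulrDl; congr (_ * p); rewrite !maxEle !minEle.
by do ?case: ifPn; rewrite -?ltNge; lra.
Qed.

Lemma caratheodory_half_space i (c : R) :
  lebesgue_outer.-caratheodory [set x : 'rV[R]_d | x 0 i <= c].
Proof.
apply: le_caratheodory_measurable => X; set H := [set x | _].
apply: le_ereal_inf_tmp => _ [F XF <-].
pose Fl k := omap (fun I => (I.1, \row_j
  if j == i then Num.min (I.2 0 j) c else I.2 0 j)) (F k).
pose Fr k := omap (fun I => (\row_j
  (if j == i then Num.max (I.1 0 j) c else I.1 0 j), I.2)) (F k).
rewrite (eq_eseriesr (g := fun k =>
    (obox_volume (Fl k))%:E + (obox_volume (Fr k))%:E)%E); last first.
  move=> k _; rewrite -EFinD /Fl /Fr; case: (F k) => [[a b]|]/=.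
    by rewrite box_volumeD.
  by rewrite addr0.
rewrite nneseriesD//; [|by move=> *; exact: obox_volume_ge0..].
apply: leeD; apply: ereal_inf_lbound.
  exists Fl => // x [/XF[k _ Fkx] Hx]; exists k => //.
  rewrite /Fl; case: (F k) Fkx => [[a b]|]//= abx j; rewrite mxE.
  have /andP[-> xb] := abx j; case: eqP => [ji|//].
  by rewrite le_min xb /= ji.
exists Fr => // x [/XF[k _ Fkx] Hx]; exists k => //.
rewrite /Fr; case: (F k) Fkx => [[a b]|]//= abx j; rewrite mxE.
have /andP[ax ->] := abx j; case: eqP => [ji|]; last by rewrite ax.
by rewrite andbT gt_max ax /= ji ltNge; apply/negP.
Qed.

End lebesgue_outer_measure.

(* 'rV[R]_d carries the complete sigma-algebra of Lebesgue measurable sets    *)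
(* (the Caratheodory sets of the outer measure).                              *)
HB.instance Definition _ (R : realType) (d : nat) :=
  Measurable.copy 'rV[R]_d (caratheodory_type (@lebesgue_outer R d)).

Definition lebesgue_rV {R : realType} {d : nat} : set 'rV[R]_d -> \bar R :=
  @lebesgue_outer R d.

Section lebesgue_rV_measure.
Context {R : realType} {d : nat}.

Let lebesgue_rV0 : lebesgue_rV (set0 : set 'rV[R]_d) = 0%E.
Proof. exact: lebesgue_outer0. Qed.

Let lebesgue_rV_ge0 (A : set 'rV[R]_d) : (0 <= lebesgue_rV A)%E.
Proof. exact: lebesgue_outer_ge0. Qed.

Let lebesgue_rV_sigma_additive : semi_sigma_additive (@lebesgue_rV R d).
Proof. exact: caratheodory_measure_sigma_additive. Qed.

HB.instance Definition _ := isMeasure.Build _ _ _ (@lebesgue_rV R d)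
  lebesgue_rV0 lebesgue_rV_ge0 lebesgue_rV_sigma_additive.

Lemma measurable_box I : measurable (box I : set 'rV[R]_d).
Proof.
case: I => a b.
have -> : box (a, b) = \bigcap_(i in [set: 'I_d])
    ([set x | x 0 i <= b 0 i] `\` [set x | x 0 i <= a 0 i]).
  apply/seteqP; split => x /= xab i.
    by have /andP[ax xb] := xab i; split => //=; apply/negP; rewrite -ltNge.
  by have [/= xb /negP] := xab i I; rewrite -ltNge => ax; apply/andP.
apply: fin_bigcap_measurable => // i _.
by apply: measurableD; exact: caratheodory_half_space.
Qed.

Lemma lebesgue_rV_sigma_finite : sigma_finite setT (@lebesgue_rV R d).
Proof.
exists (fun k => box (const_mx (- k%:R), const_mx k%:R)).
  apply/seteqP; split => // x _; exists (Num.truncn `|x|).+1 => // i /=.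
  rewrite !mxE; apply/andP.
  have xi : `|x 0 i| < (Num.truncn `|x|).+1%:R.
    apply: le_lt_trans (truncnS_gt _).
    by rewrite [leRHS]/Num.norm/= mx_normrE; apply: le_bigmax (0, i).
  by move: xi; rewrite ltr_norml => /andP[-> /ltW->].
move=> k; split; first exact: measurable_box.
apply: le_lt_trans (lebesgue_outer_obox (Some _)) _; exact: ltry.
Qed.

HB.instance Definition _ := Measure_isSigmaFinite.Build _ _ _
  (@lebesgue_rV R d) lebesgue_rV_sigma_finite.

End lebesgue_rV_measure.

Section complex_valued_functions.
Context {R : realType}.

Definition cmeasurable_fun {disp} {X : measurableType disp} (D : set X)
    (f : X -> R[i]) : Prop :=
  measurable_fun D (fun x => complex.Re (f x)) /\
  measurable_fun D (fun x => complex.Im (f x)).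

Definition cintegral {disp} {X : measurableType disp}
    (mu : {measure set X -> \bar R}) (D : set X) (f : X -> R[i]) : R[i] :=
  (\int[mu]_(x in D) complex.Re (f x)) +i* (\int[mu]_(x in D) complex.Im (f x)).

(* Norm of L^p(D; C). *)
Definition cLnorm {disp} {X : measurableType disp}
    (mu : {measure set X -> \bar R}) (D : set X) (p : \bar R) (f : X -> R[i]) :
    \bar R :=
  'N[mu]_p[(fun x => (normc (f x))%:E) \_ D]%E.

Definition cseries (u : nat -> R[i]) : R[i] :=
  limn (series (fun n => complex.Re (u n))) +i*
  limn (series (fun n => complex.Im (u n))).

End complex_valued_functions.

Section mittag_leffler.
Context {R : realType}.

(* Euler's integral; used for x > 0 only. *)
Definition Gamma (x : R) : R :=
  \int[lebesgue_measure]_(t in `]0, +oo[) (t `^ (x - 1) * expR (- t)).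

Definition mittag_leffler (alpha beta : R) (z : R[i]) : R[i] :=
  cseries (fun n => z ^+ n / (Gamma (alpha * n%:R + beta))%:C).

Definition frac_char_fun {disp} {Omega : measurableType disp}
    (P : probability Omega R) (alpha beta : R) (xi : Omega -> R) (s : R) :
    R[i] :=
  cintegral P setT (fun w => mittag_leffler alpha beta (0 +i* (s * xi w))).

End mittag_leffler.

Section domains.
Context {R : realType} {d : nat}.

Definition dotv (x y : 'rV[R]_d) : R := \sum_(i < d) x 0 i * y 0 i.

(* Near each boundary point, and in suitable orthonormal coordinates with     *)
(* last axis nu, G is the strict epigraph of a Lipschitz function; the latter *)
(* is evaluated at the orthogonal projection of y on the hyperplane nu^\perp. *)
Definition lipschitz_boundary (G : set 'rV[R]_d) : Prop :=
  forall x, (closure G `\` interior G) x ->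
  exists (nu : 'rV[R]_d) (gamma : 'rV[R]_d -> R),
    [/\ dotv nu nu = 1, lipschitz gamma &
        \forall y \near x, G y <-> gamma (y - dotv y nu *: nu) < dotv y nu].

Definition lipschitz_domain (G : set 'rV[R]_d) : Prop :=
  [/\ open G, connected G, G !=set0 & lipschitz_boundary G].

End domains.

Section hilbert_space_L2.
Context {R : realType} {d : nat} (G : set 'rV[R]_d).
Implicit Types f g : 'rV[R]_d -> R[i].

(* Elements of L^2(G; C) are represented by functions on the whole space, of  *)
(* which only the values almost everywhere on G matter.                       *)
Definition L2norm f : \bar R := cLnorm lebesgue_rV G 2%:E f.

Definition in_L2 f : Prop := cmeasurable_fun G f /\ (L2norm f < +oo)%E.

Definition inner f g : R[i] := cintegral lebesgue_rV G (fun x => f x * conjc (g x)).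

Definition L2cvg (F : nat -> 'rV[R]_d -> R[i]) f : Prop :=
  (fun n => L2norm (fun x => F n x - f x)) @ \oo --> 0%E.

Definition hilbert_basis (e : nat -> 'rV[R]_d -> R[i]) : Prop :=
  [/\ forall n, in_L2 (e n),
      forall m n, inner (e m) (e n) = (m == n)%:R &
      forall f, in_L2 f -> forall eps : R, 0 < eps ->
        exists (N : nat) (c : nat -> R[i]),
          (L2norm (fun x => (f x - \sum_(n < N) c n * e n x)%R) < eps%:E)%E].

End hilbert_space_L2.

Section dirichlet_laplacian.
Context {R : realType} {d : nat} (G : set 'rV[R]_d).
Implicit Types (phi : 'rV[R]_d -> R) (f e : 'rV[R]_d -> R[i]).

Definition partial (i : 'I_d) phi : 'rV[R]_d -> R := 'D_(delta_mx 0 i) phi.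

Definition smooth phi : Prop := forall s : seq 'I_d,
  let psi := foldr partial phi s in
  continuous psi /\ forall x i, derivable psi x (delta_mx 0 i).

Definition real_test_fun phi : Prop :=
  let K := closure [set x | phi x != 0] in
  [/\ smooth phi, compact K & K `<=` G].

(* C_c^\infty(G; C) *)
Definition test_fun f : Prop :=
  real_test_fun (fun x => complex.Re (f x)) /\
  real_test_fun (fun x => complex.Im (f x)).

Definition cpartial (i : 'I_d) f (x : 'rV[R]_d) : R[i] :=
  partial i (fun y => complex.Re (f y)) x +i*
  partial i (fun y => complex.Im (f y)) x.

Definition laplacian f (x : 'rV[R]_d) : R[i] :=
  \sum_(i < d) cpartial i (cpartial i f) x.

(* H^1_0(G), the closure of the test functions for the H^1 norm. *)
Definition in_H10 f : Prop :=
  exists (F : nat -> 'rV[R]_d -> R[i]) (g : 'I_d -> 'rV[R]_d -> R[i]),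
    [/\ forall n, test_fun (F n),
        in_L2 G f /\ L2cvg G F f,
        forall i, in_L2 G (g i) &
        forall i, L2cvg G (fun n => cpartial i (F n)) (g i)].

(* e <> 0 lies in H^1_0(G) and - Delta e = lam e in the distributions on G.   *)
Definition dirichlet_eigenfun (lam : R) e : Prop :=
  [/\ in_H10 e, L2norm G e != 0%E &
      forall v, test_fun v ->
        inner G e (fun x => - laplacian v x) = lam%:C * inner G e v].

Definition dirichlet_eigenbasis (lam : nat -> R)
    (e : nat -> 'rV[R]_d -> R[i]) : Prop :=
  [/\ 0 < lam 0%N,
      forall n, lam n <= lam n.+1,
      lam @ \oo --> +oo,
      forall n, dirichlet_eigenfun (lam n) (e n) &
      hilbert_basis G e].

End dirichlet_laplacian.

Section bochner_expectation.
Context {R : realType} {d : nat} (G : set 'rV[R]_d).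
Context {disp : measure_display} {Omega : measurableType disp}.
Variable P : probability Omega R.

(* The simple function \sum_j 1_(A_j) f_j with values in L^2(G). *)
Record L2simple := MkL2simple {
  simple_size : nat ;
  simple_set : 'I_simple_size -> set Omega ;
  simple_coef : 'I_simple_size -> 'rV[R]_d -> R[i] ;
  simple_setP : forall j, measurable (simple_set j) ;
  simple_coefP : forall j, in_L2 G (simple_coef j) }.

Definition simple_val (S : L2simple) (w : Omega) (x : 'rV[R]_d) : R[i] :=
  \sum_(j < simple_size S) (\1_(@simple_set S j) w)%:C * @simple_coef S j x.

Definition simple_expectation (S : L2simple) (x : 'rV[R]_d) : R[i] :=
  \sum_(j < simple_size S) (fine (P (@simple_set S j)))%:C * @simple_coef S j x.

(* Y is Bochner integrable in L^2(G), with integral m. *)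
Definition is_expectation (Y : Omega -> 'rV[R]_d -> R[i])
    (m : 'rV[R]_d -> R[i]) : Prop :=
  exists S : nat -> L2simple,
    let dist k w := L2norm G (fun x => Y w x - simple_val (S k) w x) in
    [/\ forall k, measurable_fun [set: Omega] (dist k),
        (fun k => \int[P]_w dist k w)%E @ \oo --> 0%E &
        L2cvg G (fun k => simple_expectation (S k)) m].

End bochner_expectation.

Section averaged_controllability.
Context {R : realType} {d : nat}.
Variables (alpha T : R) (G G0 : set 'rV[R]_d).
Variables (lam : nat -> R) (e : nat -> 'rV[R]_d -> R[i]).
Implicit Types (Y : 'rV[R]_d -> R[i]) (u : R * 'rV[R]_d -> R[i]).

(* The control 1_{G0} u(s, .); the values of u off (0,T) x G0 are irrelevant. *)
Definition localized u (s : R) (x : 'rV[R]_d) : R[i] := (\1_G0 x)%:C * u (s, x).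

(* Coefficient on e_n of the solution at time t. *)
Definition solution_coef (t xi : R) (y0 : 'rV[R]_d -> R[i]) u (n : nat) : R[i] :=
  let arg (r : R) : R[i] := 0 +i* (- (xi * lam n * r `^ alpha)) in
  inner G y0 (e n) * mittag_leffler alpha 1 (arg t) +
  cintegral lebesgue_measure `]0, t[ (fun s =>
    inner G (localized u s) (e n) * ((t - s) `^ (alpha - 1))%:C *
    mittag_leffler alpha alpha (arg (t - s))).

(* Y is y(t, .; xi; y0; u), as the sum of a series converging in L^2(G).      *)
Definition solution_at (t xi : R) (y0 : 'rV[R]_d -> R[i]) u Y : Prop :=
  in_L2 G Y /\
  L2cvg G (fun N x => \sum_(n < N) solution_coef t xi y0 u n * e n x) Y.

(* Norm of L^\infty((0,T) x G0). *)
Definition Linfnorm u : \bar R :=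
  cLnorm (lebesgue_measure \x lebesgue_rV)%E (`]0, T[ `*` G0) +oo%E u.

Definition exactly_averaged_controllable {disp} {Omega : measurableType disp}
    (P : probability Omega R) (xi : Omega -> R) : Prop :=
  exists2 C : R, 0 < C &
    forall y0 y1 : 'rV[R]_d -> R[i], in_L2 G y0 -> in_L2 G y1 ->
    exists u,
      [/\ cmeasurable_fun (`]0, T[ `*` G0) u,
          (Linfnorm u <= C%:E * (L2norm G y0 + L2norm G y1))%E &
          exists Y : Omega -> 'rV[R]_d -> R[i],
            (forall w, solution_at T (xi w) y0 u (Y w)) /\
            is_expectation G P Y y1].

End averaged_controllability.

(* Main.v *)
Require Import Defs.
Set Warnings "-notation-overridden,-ambiguous-paths,-notation-incompatible-prefix".
From mathcomp Require Import all_boot all_order all_algebra.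
From mathcomp Require Import all_classical all_reals all_analysis.
From mathcomp Require Import complex.
From mathcomp Require Import measurable_realfun ess_sup_inf.
From mathcomp Require Import ring lra.
Import Order.TTheory GRing.Theory Num.Theory.
Import numFieldNormedType.Exports.
Import ComplexField.Normc.
Local Open Scope classical_set_scope.
Local Open Scope ring_scope.

(** Exact averaged controllability is tested on the data y0 = 0, y1 = e_n. The
    control u_n that it provides is bounded by C uniformly in n, because e_n has
    norm 1. Taking the inner product with e_n and averaging,

      1 = E Re <y(T), e_n>
        = Re \int_0^T <1_(G0) u_n(s), e_n> (T - s)^(alpha - 1)
                      phi(- lambda_n (T - s)^alpha) ds,

    where phi is the fractional characteristic function of xi. The first factor is
    bounded uniformly in n and s, phi is bounded and tends to 0 at -oo, and
    lambda_n tends to +oo: by dominated convergence the right-hand side tends to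
    0, which is absurd. The inequality is averaged_coef_le and the limit is
    Rintegral_kernel_vanish.

    Exchanging the expectation with the integral in time requires a bound on
    E_(alpha, alpha) over the imaginary axis, uniform in xi
    (normc_mittag_leffler_le). It comes from a time discretization. The kernel
    t^(alpha - 1) E_(alpha, alpha)(i x t^alpha) solves the fractional equation
    D^alpha y = i x y with a Dirac source; the implicit Gruenwald-Letnikov scheme
    of step 1/N for this equation has generating function
    1 / ((1 - z)^alpha - i mu) with mu = x / N^alpha. Since the coefficients of
    1 - (1 - z)^alpha are nonnegative and |1 - i mu| >= 1, the modulus of the
    numerical solution is at most the solution for mu = 0 (discrete_ml_le). As N
    tends to infinity the coefficients of (1 - z)^(- s), suitably scaled, tend to
    1 / Gamma(s) (gamma_ratio_cvg), and the comparison becomes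
    |E_(alpha, alpha)(i x)| <= 1 / Gamma(alpha). The expansion in powers of mu is
    truncated at M terms throughout, so that only finite sums pass to the limit
    in N; the truncation error is a term of a convergent series in M.

    The identity 1 = E Re <y(T), e_n> follows from the continuity of the inner
    product along the series defining y(T) (Re_inner_L2cvg) and along the simple
    functions defining the Bochner expectation (Re_inner_expectation). The bound
    on u_n holds only for almost every (s, x); cutoff_section turns it into a
    bound at every time s. *)

(** * The Gamma function *)

Section gamma.
Context {R : realType}.
Implicit Types x a b t : R.
Notation mu := (@lebesgue_measure R).

Definition euler_fun x t : R := t `^ (x - 1) * expR (- t).

Lemma euler_fun_ge0 x t : 0 <= euler_fun x t.
Proof. by rewrite mulr_ge0 ?powR_ge0 ?expR_ge0. Qed.

Lemma measurable_euler_fun x : measurable_fun setT (euler_fun x).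
Proof.
apply: measurable_funM; first exact: measurable_powR.
by apply: measurableT_comp => //; exact: measurable_expR.
Qed.

Lemma is_derive_euler_fun x t : 0 < t ->
  is_derive t 1 (euler_fun (x + 1)) (x * euler_fun x t - euler_fun (x + 1) t).
Proof.
move=> t0; rewrite /euler_fun addrK.
have h1 : is_derive t 1 (fun t => t `^ x) (x * t `^ (x - 1)) by exact: is_derive1_powR.
have h2 : is_derive t 1 (fun t => expR (- t)) (- expR (- t)).
  have := @is_derive1_comp R expR (fun t => - t) t (expR (- t)) (-1).
  by rewrite mulrN1; apply.
have h3 := is_deriveM h1 h2.
apply: is_derive_eq.
rewrite /GRing.scale/=.
by ring.
Qed.

Lemma continuous_euler_fun x t : 0 < t -> {for t, continuous (euler_fun x)}.
Proof.
move=> t0; rewrite -(subrK 1 x).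
by apply/differentiable_continuous/derivable1_diffP/ex_derive/is_derive_euler_fun.
Qed.

Lemma within_continuous_euler_fun x a b : 0 < a ->
  {within `[a, b], continuous (euler_fun x)}.
Proof.
move=> a0; apply: continuous_in_subspaceT => t; rewrite inE/= in_itv/= => /andP[ta _].
by apply: continuous_euler_fun; exact: lt_le_trans ta.
Qed.

Lemma integrable_euler_fun_itv x a b : 0 < a ->
  mu.-integrable `[a, b] (EFin \o euler_fun x).
Proof.
move=> a0; apply: continuous_compact_integrable; first exact: segment_compact.
exact: within_continuous_euler_fun.
Qed.

(** Integration by parts, as the fundamental theorem of calculus for
    t^x e^(-t). The interval stays away from 0, where the integrand may be
    singular. *)
Lemma Rintegral_euler_fun_rec x a b : 0 < a -> a < b ->
  x * (\int[mu]_(t in `[a, b]) euler_fun x t) =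
  \int[mu]_(t in `[a, b]) euler_fun (x + 1) t +
    (euler_fun (x + 1) b - euler_fun (x + 1) a).
Proof.
move=> a0 ab.
have i1 := integrable_euler_fun_itv x a b a0.
have i2 := integrable_euler_fun_itv (x + 1) a b a0.
rewrite -RintegralZl//.
have ix : mu.-integrable `[a, b] (EFin \o (fun t => x * euler_fun x t)).
  by rewrite (_ : _ \o _ = (fun t => x%:E * (EFin \o euler_fun x) t)%E); [exact: integrableZl|].
apply/eqP; rewrite -subr_eq0 opprD addrA subr_eq0 -RintegralB//.
rewrite /Rintegral (@continuous_FTC2 _ _ (euler_fun (x + 1)))//.
- apply: continuous_in_subspaceT => t; rewrite inE/= in_itv/= => /andP[ta _].
  have t0 := lt_le_trans a0 ta.
  apply: cvgB; last exact: continuous_euler_fun.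
  by apply: cvgMl_tmp; exact: continuous_euler_fun.
- split.
  + move=> t; rewrite in_itv/= => /andP[/(lt_trans a0) t0 _].
    by have [] := is_derive_euler_fun x t t0.
  + by apply: cvg_at_right_filter; exact: continuous_euler_fun.
  + by apply: cvg_at_left_filter; apply: continuous_euler_fun; exact: lt_trans ab.
- move=> t; rewrite in_itv/= => /andP[/(lt_trans a0) t0 _].
  rewrite derive1E.
  by have [_ ->] := is_derive_euler_fun x t t0.
Qed.

(** The value is an extended real so that the recurrence can be proved first
    and finiteness deduced from it. *)
Definition eGamma x : \bar R := (\int[mu]_(t in `]0%R, +oo[) (euler_fun x t)%:E)%E.

Lemma eGamma_ge0 x : (0 <= eGamma x)%E.
Proof. by apply: integral_ge0 => t _; rewrite lee_fin euler_fun_ge0. Qed.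

(** Monotone convergence along [1/(n+2), n+2]; starting at n + 2 keeps every
    interval nondegenerate. *)
Lemma cvg_eGamma x :
  ((\int[mu]_(t in `[n.+2%:R^-1, n.+2%:R]) euler_fun x t)%:E)%E @[n --> \oo] --> eGamma x.
Proof.
rewrite /eGamma.
have -> : `]0, +oo[%classic = \bigcup_n [set` `[n.+2%:R^-1, n.+2%:R : R]].
  apply/seteqP; split => t /=.
    rewrite in_itv/= andbT => t0.
    pose m := maxn (Num.truncn t) (Num.truncn t^-1).
    have ht : t < m.+1%:R.
      by apply: lt_le_trans (truncnS_gt _) _; rewrite ler_nat ltnS leq_maxl.
    have ht' : t^-1 < m.+1%:R.
      by apply: lt_le_trans (truncnS_gt _) _; rewrite ler_nat ltnS leq_maxr.
    have h12 : m.+1%:R <= m.+2%:R :> R by rewrite ler_nat.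
    exists m => //=; rewrite in_itv/=; apply/andP; split.
      rewrite -[leRHS]invrK lef_pV2 ?posrE ?invr_gt0//.
      by apply: le_trans h12; exact: ltW.
    by apply: le_trans h12; exact: ltW.
  move=> [n _] /=; rewrite !in_itv/= andbT => /andP[h _].
  by apply: lt_le_trans h; rewrite invr_gt0.
have := @ge0_nondecreasing_set_cvg_integral _ (measurableTypeR R) R
  (fun n => [set` `[n.+2%:R^-1, n.+2%:R : R]]) (EFin \o euler_fun x) mu.
move=> /(_ _ _ _ _); rewrite /comp => H.
apply: cvg_trans; last apply: H.
- apply: near_eq_cvg; near=> n.
  rewrite /Rintegral fineK//; apply: integrable_fin_num => //.
  by apply: integrable_euler_fun_itv; rewrite invr_gt0.
- move=> m n mn; apply/subsetPset => t/=; rewrite !in_itv/= => /andP[h1 h2].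
  apply/andP; split.
    by apply: le_trans h1; rewrite lef_pV2 ?posrE ?ler_nat// !ltnS.
  by apply: le_trans h2 _; rewrite ler_nat !ltnS.
- by move=> i; exact: measurable_itv.
- move=> i; apply: measurable_funTS; apply/measurable_EFinP; exact: measurable_euler_fun.
- by move=> i t _; rewrite lee_fin euler_fun_ge0.
Unshelve. all: by end_near.
Qed.

Lemma exprn_expRN_le (k : nat) t : 0 < t -> t ^+ k * expR (- t) <= (k.+1)`!%:R / t.
Proof.
move=> t0; rewrite ler_pdivlMr// mulrAC -exprSr expRN.
rewrite ler_pdivrMr ?expR_gt0//.
have f0 : 0 < (k.+1)`!%:R :> R by rewrite ltr0n fact_gt0.
rewrite -ler_pdivrMl// mulrC.
by apply: le_trans (@expR_ge1Dxn _ t k (ltW t0)); rewrite lerDr.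
Qed.

Lemma euler_fun_cvg_at_infty x :
  euler_fun x n.+2%:R @[n --> \oo] --> (0 : R).
Proof.
(* t^(x-1) <= t^(k+1) for t >= 1, and e^t dominates t^(k+2) / (k+2)! *)
pose k := Num.truncn `|x|; pose C : R := (k.+2)`!%:R.
apply: (@squeeze_cvgr _ _ _ _ (fun=> 0) (fun n : nat => C * n.+1%:R^-1)).
- near=> n; rewrite euler_fun_ge0/=.
  apply: (@le_trans _ _ (n.+2%:R ^+ k.+1 * expR (- n.+2%:R))).
    rewrite ler_wpM2r ?expR_ge0// -powR_mulrn//.
    apply: ler_powR; first by rewrite ler1n.
    have : `|x| < k.+1%:R by exact: truncnS_gt.
    have := ler_norm x; lra.
  apply: le_trans (exprn_expRN_le _ _ _) _ => //.
  by rewrite ler_wpM2l// lef_pV2 ?posrE// ler_nat.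
- exact: cvg_cst.
- rewrite -[X in _ --> X](mulr0 C); apply: cvgMl_tmp; exact: cvg_harmonic.
Unshelve. all: by end_near.
Qed.

Lemma cvg_inv_natS2 : (n.+2%:R^-1 : R) @[n --> \oo] --> (0 : R).
Proof. have := @cvg_harmonic R; rewrite -cvg_shiftS; exact. Qed.

Lemma euler_fun_cvg_at0 x : 0 < x ->
  euler_fun (x + 1) n.+2%:R^-1 @[n --> \oo] --> (0 : R).
Proof.
move=> x0; rewrite /euler_fun addrK.
rewrite -[X in _ --> X](mul0r (expR (- 0))); apply: cvgM.
  have /cvg_at_rightP := powR_cvg0 x0; apply; split; first by move=> n; rewrite invr_gt0.
  exact: cvg_inv_natS2.
apply: (@cvg_comp _ _ _ (fun n : nat => n.+2%:R^-1 : R) (fun t => expR (- t)) _ (nbhs (0 : R))).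
  exact: cvg_inv_natS2.
apply: continuous_comp; last exact: continuous_expR.
exact: continuousN.
Qed.

(** Both Euler integrals are limits of integrals over compact intervals, where
    the recurrence holds up to boundary terms that vanish at 0 and at infinity. *)
Lemma eGamma_rec x : 0 < x ->
  (x%:E * eGamma x = eGamma (x + 1))%E.
Proof.
move=> x0.
have h := cvg_eGamma x.
have h1 := cvg_eGamma (x + 1).
have d0 : (euler_fun (x + 1) n.+2%:R - euler_fun (x + 1) n.+2%:R^-1)%:E @[n --> \oo] --> 0%:E.
  apply/fine_cvgP; split; first by near=> n.
  by rewrite -[X in _ --> X](subr0 0); apply: cvgB;
    [exact: euler_fun_cvg_at_infty|exact: euler_fun_cvg_at0].
have hx : (x%:E * (\int[mu]_(t in `[n.+2%:R^-1, n.+2%:R]) euler_fun x t)%:E)%E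
    @[n --> \oo] --> (x%:E * eGamma x)%E by exact: cvgeZl.
have hs : (x%:E * (\int[mu]_(t in `[n.+2%:R^-1, n.+2%:R]) euler_fun x t)%:E)%E
    @[n --> \oo] --> (eGamma (x + 1) + 0)%E.
  suff -> : (fun n : nat => x%:E * (\int[mu]_(t in `[n.+2%:R^-1, n.+2%:R]) euler_fun x t)%:E)%E =
    (fun n : nat => (\int[mu]_(t in `[n.+2%:R^-1, n.+2%:R]) euler_fun (x + 1) t)%:E +
    (euler_fun (x + 1) n.+2%:R - euler_fun (x + 1) n.+2%:R^-1)%:E)%E.
    by apply: cvgeD => //; rewrite fin_num_adde_defl.
  apply/funext => n; rewrite -EFinM -EFinD Rintegral_euler_fun_rec ?invr_gt0//.
  by apply: (@lt_trans _ _ 1); rewrite ?invf_lt1 ?ltr1n.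
rewrite adde0 in hs.
exact: (cvg_unique _ hx hs).
Unshelve. all: by end_near.
Qed.

Lemma eGamma1 : eGamma 1 = 1%E.
Proof.
have -> : 1%E = (0%:E - (- expR (- 0))%:E)%E :> \bar R.
  by rewrite oppr0 expR0 -EFinB opprK add0r.
rewrite -(@ge0_continuous_FTC2y R (fun t => expR (- t)) (fun t => - expR (- t)) 0 0).
- rewrite /eGamma -[RHS]integral_itv_obnd_cbnd; last first.
    apply: measurable_funTS; apply/measurable_EFinP.
    by apply: measurableT_comp => //; exact: measurable_expR.
  by apply: eq_integral => t _; rewrite /euler_fun subrr powRr0 mul1r.
- by move=> x _; exact: expR_ge0.
- apply: continuous_in_subspaceT => t _.
  by apply: continuous_comp; [exact: continuousN|exact: continuous_expR].
- by rewrite -[X in _ --> X]oppr0; apply: cvgN; exact: cvgr_expR.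
- by move=> x _; exact: ex_derive.
- apply: cvg_at_right_filter; apply: cvgN.
  by apply: continuous_comp; [exact: continuousN|exact: continuous_expR].
- move=> t _; rewrite derive1E.
  have h2 : is_derive t 1 (fun t => expR (- t)) (- expR (- t)).
    have := @is_derive1_comp R expR (fun t => - t) t (expR (- t)) (-1).
    by rewrite mulrN1; apply.
  have [_] := is_deriveN h2.
  by rewrite opprK.
Qed.

Lemma eGamma_nat (n : nat) : eGamma n.+1%:R \is a fin_num.
Proof.
elim: n => [|n IH]; first by rewrite eGamma1.
by rewrite -natr1 -eGamma_rec// fin_numM.
Qed.

(** By the recurrence it is enough to treat x + 1. There t^x <= 1 + t^(n+1) for
    an integer n + 1 > x, and the Euler integral at an integer is a factorial. *)
Lemma eGamma_fin x : 0 < x -> eGamma x \is a fin_num.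
Proof.
move=> x0.
suff h1 : eGamma (x + 1) \is a fin_num.
  move: h1; rewrite -eGamma_rec// => h1.
  have -> : eGamma x = (x^-1%:E * (x%:E * eGamma x))%E.
    by rewrite muleA -EFinM mulVf ?gt_eqF// mul1e.
  by rewrite fin_numM.
pose n := Num.truncn x.
have xn : x < n.+1%:R by exact: truncnS_gt.
rewrite ge0_fin_numE ?eGamma_ge0//.
apply: (@le_lt_trans _ _ (eGamma 1 + eGamma n.+2%:R)%E); last first.
  by rewrite lte_add_pinfty// ?eGamma1 ?ltry// -ge0_fin_numE ?eGamma_ge0// eGamma_nat.
have m y : measurable_fun (`]0, +oo[%classic : set R) (fun t => (euler_fun y t)%:E).
  by apply: measurable_funTS; apply/measurable_EFinP; exact: measurable_euler_fun.
rewrite /eGamma -ge0_integralD//; try by move=> t _; rewrite lee_fin euler_fun_ge0.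
- apply: ge0_le_integral => //.
  + by move=> t _; rewrite lee_fin euler_fun_ge0.
  + exact: m.
  + by apply: emeasurable_funD; exact: m.
move=> t; rewrite /= in_itv/= andbT => t0.
rewrite lee_fin /euler_fun subrr powRr0 -mulrDl ler_wpM2r ?expR_ge0//.
rewrite addrK -natr1 addrK.
have [t1|t1] := leP t 1.
  apply: (@le_trans _ _ 1); last by rewrite lerDl powR_ge0.
  by rewrite -[leRHS](powRr0 t) ger_powR ?t0// ltW.
by apply: (@le_trans _ _ (t `^ n.+1%:R)); rewrite ?lerDr// ler_powR// ltW.
- exact: m.
- exact: m.
Qed.

Lemma EFin_Gamma x : 0 < x -> (Gamma x)%:E = eGamma x.
Proof. by move=> x0; rewrite /Gamma/Rintegral fineK//; exact: eGamma_fin. Qed.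

Lemma Gamma_rec x : 0 < x -> Gamma (x + 1) = x * Gamma x.
Proof.
move=> x0; apply: EFin_inj; rewrite EFinM !EFin_Gamma ?eGamma_rec//.
by rewrite addr_gt0.
Qed.

(** The concave function t^th lies below its tangent at t = 1. *)
Lemma powR_young t th : 0 <= t -> 0 < th < 1 -> t `^ th <= (1 - th) + th * t.
Proof.
move=> t0 /andP[th0 th1].
have h1 : 0 < 1 - th by rewrite subr_gt0.
have := @conjugate_powR R (t `^ th) 1 th^-1 (1 - th)^-1 (powR_ge0 _ _) ler01.
rewrite !invr_gt0 !invrK mulr1 powR1 mul1r -powRrM mulfV ?gt_eqF// powRr1// => /(_ th0 h1).
have -> : th + (1 - th) = 1 by ring.
by move=> /(_ erefl); rewrite [t * _]mulrC [leRHS]addrC.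
Qed.

Lemma integrable_euler_fun x : 0 < x -> mu.-integrable `]0, +oo[ (EFin \o euler_fun x).
Proof.
move=> x0; apply/integrableP; split.
  by apply: measurable_funTS; apply/measurable_EFinP; exact: measurable_euler_fun.
under eq_integral do rewrite gee0_abs ?lee_fin ?euler_fun_ge0//.
by rewrite -ge0_fin_numE ?eGamma_ge0//; exact: eGamma_fin.
Qed.

(** Integrating (t / x)^th <= (1 - th) + th (t / x) against t^(x-1) e^(-t)
    gives the result, since by the recurrence the right-hand side integrates to
    (1 - th) Gamma(x) + th Gamma(x). *)
Lemma GammaD_le x (th : R) : 0 < x -> 0 < th < 1 -> Gamma (x + th) <= x `^ th * Gamma x.
Proof.
move=> x0 /andP[th0 th1].
suff: x `^ (- th) * Gamma (x + th) <= (1 - th) * Gamma x + (th / x) * Gamma (x + 1).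
  rewrite Gamma_rec// mulrA divfK ?gt_eqF// -mulrDl subrK mul1r powRN.
  by rewrite ler_pdivrMl ?powR_gt0.
have xth : 0 < x + th by rewrite addr_gt0.
have x1 : 0 < x + 1 by rewrite addr_gt0.
have i1 := integrable_euler_fun x x0.
have i2 := integrable_euler_fun (x + 1) x1.
have i3 := integrable_euler_fun (x + th) xth.
have iZ c y : 0 < y -> mu.-integrable `]0, +oo[ (EFin \o (fun t => c * euler_fun y t)).
  move=> y0.
  rewrite (_ : _ \o _ = (fun t => c%:E * (EFin \o euler_fun y) t)%E)//.
  by apply: integrableZl => //; exact: integrable_euler_fun.
rewrite /Gamma -!RintegralZl//.
rewrite -RintegralD ?iZ//.
apply: le_Rintegral => //; [exact: iZ| |].
  rewrite (_ : _ \o _ = (EFin \o (fun t => (1 - th) * euler_fun x t)%R) \+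
    (EFin \o (fun t => (th / x) * euler_fun (x + 1) t)%R))%E//.
  by apply: integrableD => //; exact: iZ.
move=> t; rewrite /= in_itv/= andbT => t0.
rewrite !mulrA -mulrDl ler_wpM2r ?expR_ge0//.
have -> : t `^ (x + 1 - 1) = t * t `^ (x - 1).
  by rewrite addrK mulr_powRB1// ltW.
have -> : t `^ (x + th - 1) = t `^ (x - 1) * t `^ th.
  by rewrite addrAC [LHS]powRD// (gt_eqF t0) implybT.
have -> : x `^ (- th) * (t `^ (x - 1) * t `^ th) = t `^ (x - 1) * (t / x) `^ th.
  by rewrite powRM ?invr_ge0 ?ltW// -powR_inv1 ?ltW// -powRrM mulN1r; ring.
have -> : (1 - th) * t `^ (x - 1) + th / x * (t * t `^ (x - 1)) =
  t `^ (x - 1) * ((1 - th) + th * (t / x)) by ring.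
by rewrite ler_wpM2l ?powR_ge0// powR_young ?th0// divr_ge0// ltW.
Qed.

Lemma Gamma_nat_gt0 (n : nat) : 0 < Gamma (n.+1%:R : R).
Proof.
elim: n => [|n IH]; first by rewrite -lte_fin EFin_Gamma// eGamma1 lte_fin.
by rewrite -natr1 Gamma_rec// mulr_gt0.
Qed.

(** If Gamma vanished at x, then GammaD_le would make it vanish at an integer. *)
Lemma Gamma_gt0 (x : R) : 0 < x -> 0 < Gamma x.
Proof.
move=> x0.
have G0 (y : R) : 0 <= Gamma y by apply: Rintegral_ge0 => t _; rewrite mulr_ge0 ?powR_ge0 ?expR_ge0.
rewrite lt_def G0 andbT; apply/eqP => h.
pose k : nat := Num.truncn x.
have /andP[kx xk] : k%:R <= x < k.+1%:R by exact: truncn_itv (ltW x0).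
suff : Gamma (k.+1%:R : R) = 0 by move/eqP; rewrite gt_eqF// Gamma_nat_gt0.
move: kx; rewrite le_eqVlt => /predU1P[kx|kx].
  by rewrite -natr1 kx Gamma_rec// h mulr0.
(* GammaD_le transports the zero from x to k + 1 = x + th *)
have th01 : 0 < k.+1%:R - x < 1.
  by rewrite subr_gt0 xk/= ltrBlDr -natr1 addrC ltrD2l.
apply/eqP; rewrite eq_le G0 andbT; have := GammaD_le _ _ x0 th01.
by rewrite h mulr0 addrC subrK.
Qed.

End gamma.

(** * Coefficients of powers of 1 - z, and Gamma quotients *)

Section rising_coefficients.
Context {R : realType}.
Implicit Types s t : R.

(** The coefficient of z^n in (1 - z)^(- s). *)
Definition risecoef s (n : nat) : R := \prod_(j < n) ((s + j%:R) / j.+1%:R).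

Lemma risecoef0 s : risecoef s 0 = 1.
Proof. by rewrite /risecoef big_ord0. Qed.

Lemma risecoefS s n : n.+1%:R * risecoef s n.+1 = (s + n%:R) * risecoef s n.
Proof.
rewrite /risecoef big_ord_recr/=; set p := \prod_(i < n) _.
by rewrite [p * _]mulrC mulrA mulrCA divff ?pnatr_eq0// mulr1.
Qed.

Lemma risecoef_ge0 s n : 0 <= s -> 0 <= risecoef s n.
Proof. by move=> s0; apply: prodr_ge0 => j _; rewrite divr_ge0// addr_ge0. Qed.

(** The series 1 - (1 - z)^s has nonnegative coefficients; this sign makes the
    comparison argument of discrete_ml_le work. *)
Lemma risecoef_le0 s n : 0 <= s <= 1 -> risecoef (- s) n.+1 <= 0.
Proof.
move=> /andP[s0 s1]; rewrite /risecoef big_ord_recl/= addr0.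
rewrite mulr_le0_ge0//; first by rewrite divr1 oppr_le0.
apply: prodr_ge0 => j _; rewrite divr_ge0//= addrC subr_ge0.
by apply: le_trans s1 _; rewrite /bump leq0n add1n ler1n.
Qed.

(** Vandermonde's identity, (1 - z)^(- s) (1 - z)^(- t) = (1 - z)^(- (s + t)).
    Both sides satisfy the same first-order recurrence in n, because the factor
    n + 1 splits as k + (n + 1 - k). *)
Lemma risecoef_conv s t n :
  \sum_(k < n.+1) risecoef s k * risecoef t (n - k) = risecoef (s + t) n.
Proof.
elim: n => [|n IH]; first by rewrite big_ord_recl big_ord0 !risecoef0 mulr1 addr0.
have n0 : n.+1%:R != 0 :> R by rewrite pnatr_eq0.
apply: (mulfI n0); rewrite risecoefS -IH.
rewrite mulr_sumr.
transitivity (\sum_(k < n.+2) (k%:R * risecoef s k * risecoef t (n.+1 - k) +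
    risecoef s k * ((n.+1 - k)%:R * risecoef t (n.+1 - k)))).
  apply: eq_bigr => k _.
  have -> : n.+1%:R = k%:R + (n.+1 - k)%:R :> R.
    by rewrite -natrD subnKC// -ltnS.
  by ring.
rewrite big_split/= big_ord_recl/= !mul0r add0r.
rewrite [X in _ + X]big_ord_recr/= subnn mul0r mulr0 addr0.
rewrite -big_split/= mulr_sumr; apply: eq_bigr => k _.
rewrite /bump leq0n add1n subSS risecoefS subSn; last by rewrite -ltnS.
rewrite risecoefS.
have -> : n%:R = k%:R + (n - k)%:R :> R by rewrite -natrD subnKC// -ltnS.
by ring.
Qed.

Lemma Gamma_risecoef s n : 0 < s ->
  Gamma (s + n%:R) = risecoef s n * n`!%:R * Gamma s.
Proof.
move=> s0; elim: n => [|n IH]; first by rewrite addr0 risecoef0 mulr1 mul1r.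
rewrite -natr1 addrA Gamma_rec ?ltr_wpDr// IH factS natrM.
by rewrite !mulrA -[in RHS](mulrC n.+1%:R) risecoefS; ring.
Qed.

Lemma Gamma_fact n : Gamma n.+1%:R = n`!%:R :> R.
Proof.
elim: n => [|n IH]; first by apply: EFin_inj; rewrite EFin_Gamma// eGamma1.
by rewrite -natr1 Gamma_rec// IH factS natrM.
Qed.

End rising_coefficients.

Section gamma_quotients.
Context {R : realType}.
Variable alpha : R.
Hypothesis ha : 0 < alpha < 1.
Implicit Types s x : R.

Let a0 : 0 < alpha. Proof. by case/andP: ha. Qed.

(** This is GammaD_le at x + alpha with exponent 1 - alpha. *)
Lemma GammaD_ge x : 0 < x -> x `^ alpha * (x / (x + alpha)) * Gamma x <= Gamma (x + alpha).
Proof.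
move=> x0.
have xa : 0 < x + alpha by rewrite addr_gt0.
have a1 : 0 < 1 - alpha < 1 by move: ha; lra.
have := GammaD_le _ _ xa a1.
have -> : x + alpha + (1 - alpha) = x + 1 by ring.
rewrite Gamma_rec//; set y := x + alpha; set G := Gamma x; set H := Gamma y.
have -> : y `^ (1 - alpha) = y / y `^ alpha.
  by rewrite powRD ?powRN ?powRr1 ?(ltW xa)// (gt_eqF xa) implybT.
have Q0 : 0 < y `^ alpha by rewrite powR_gt0.
have P0 : 0 <= x `^ alpha by rewrite powR_ge0.
have PQ : x `^ alpha <= y `^ alpha.
  by rewrite ge0_ler_powR ?nnegrE ?(ltW a0) ?(ltW x0) ?(ltW xa)// lerDl ltW.
have H0 : 0 <= H by rewrite ltW// Gamma_gt0.
move=> h.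
have -> : x `^ alpha * (x / y) * G = x `^ alpha / y * (x * G) by ring.
apply: (@le_trans _ _ (x `^ alpha / y * (y / y `^ alpha * H))).
  by rewrite ler_wpM2l// divr_ge0// ltW.
have -> : x `^ alpha / y * (y / y `^ alpha * H) = x `^ alpha / y `^ alpha * H.
  by field; rewrite !gt_eqF.
by rewrite ler_piMl// ler_pdivrMr// mul1r.
Qed.

(** Up to the factor Gamma s, this is N^(1 - s) times the coefficient of z^N in
    (1 - z)^(- s), with N = n + 1 (see risecoef_gamma_ratio); the claim that it
    tends to 1 is Euler's limit formula for Gamma. *)
Definition gamma_ratio s (n : nat) : R := Gamma (s + n.+1%:R) / (n.+1%:R `^ s * n`!%:R).

Lemma gamma_ratio0 n : gamma_ratio 0 n = 1.
Proof. by rewrite /gamma_ratio powRr0 add0r mul1r Gamma_fact divff// gt_eqF// ltr0n fact_gt0. Qed.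

(** GammaD_le and GammaD_ge at s + N compare Gamma(s + N + alpha) with
    N^alpha Gamma(s + N) up to factors that tend to 1. *)
Lemma gamma_ratio_step s n : 0 <= s ->
  gamma_ratio s n * (n.+1%:R / (n.+1%:R + alpha)) <= gamma_ratio (s + alpha) n <= gamma_ratio s n * (1 + s / n.+1%:R).
Proof.
move=> s0.
set N : R := n.+1%:R; have N0 : 0 < N by rewrite ltr0n.
have f0 : 0 < n`!%:R :> R by rewrite ltr0n fact_gt0.
have x0 : 0 < s + N by rewrite ltr_wpDl.
have na : 0 < N `^ alpha by rewrite powR_gt0.
have ns : 0 < N `^ s by rewrite powR_gt0.
have D0 : 0 < N `^ s * N `^ alpha * n`!%:R by rewrite !mulr_gt0.
have G0 := Gamma_gt0 _ x0.
have D : N `^ (s + alpha) = N `^ s * N `^ alpha by rewrite powRD// (gt_eqF N0) implybT.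
rewrite /gamma_ratio -/N D; have -> : s + alpha + N = s + N + alpha by ring.
apply/andP; split.
- rewrite ler_pdivlMr//.
  apply: le_trans (GammaD_ge _ x0).
  have -> : Gamma (s + N) / (N `^ s * n`!%:R) * (N / (N + alpha)) * (N `^ s * N `^ alpha * n`!%:R)
    = N `^ alpha * (N / (N + alpha)) * Gamma (s + N).
    by field; rewrite !gt_eqF//= addr_gt0.
  have y0 : 0 < N + alpha by rewrite addr_gt0.
  have z0 : 0 < s + N + alpha by rewrite addr_gt0.
  have h1 : N `^ alpha <= (s + N) `^ alpha.
    by rewrite ge0_ler_powR ?nnegrE ?(ltW a0) ?(ltW N0) ?(ltW x0)// lerDr.
  have h2 : N / (N + alpha) <= (s + N) / (s + N + alpha).
    rewrite ler_pdivrMr// mulrAC ler_pdivlMr//.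
    have h : 0 <= s * alpha by rewrite mulr_ge0// ltW.
    by nra.
  by rewrite ler_pM2r//; apply: ler_pM; rewrite ?(ltW na)// divr_ge0// ltW.
- rewrite ler_pdivrMr//.
  apply: le_trans (GammaD_le _ _ x0 ha) _.
  have -> : Gamma (s + N) / (N `^ s * n`!%:R) * (1 + s / N) * (N `^ s * N `^ alpha * n`!%:R)
    = N `^ alpha * (1 + s / N) * Gamma (s + N).
    by field; rewrite !gt_eqF.
  rewrite ler_pM2r//.
  have -> : s + N = N * (1 + s / N) by field; rewrite gt_eqF.
  have h0 : 0 <= s / N by rewrite divr_ge0// ltW.
  rewrite powRM ?(ltW N0) ?addr_ge0// ler_pM2l//.
  by rewrite ler1_powR ?lerDl//; case/andP: ha => _ /ltW.
Qed.

Let cvg1D (c : R) : (1 + c / n.+1%:R) @[n --> \oo] --> (1 : R).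
Proof.
have h : (1 + c / n.+1%:R) @[n --> \oo] --> (1 + c * 0 : R).
  by apply: cvgD; [exact: cvg_cst|apply: cvgMl_tmp; exact: cvg_harmonic].
by rewrite mulr0 addr0 in h.
Qed.

(** Only the exponents alpha m occur in the Mittag-Leffler series, and they are
    reached from 0 by steps of length alpha. *)
Lemma gamma_ratio_cvg (m : nat) : gamma_ratio (alpha * m%:R) n @[n --> \oo] --> (1 : R).
Proof.
elim: m => [|m IH].
  by under eq_fun do rewrite mulr0 gamma_ratio0; exact: cvg_cst.
have -> : alpha * m.+1%:R = alpha * m%:R + alpha by rewrite -natr1; ring.
set s := alpha * m%:R in IH *.
have s0 : 0 <= s by rewrite mulr_ge0// ltW.
apply: (@squeeze_cvgr _ _ _ _ (fun n => gamma_ratio s n * (n.+1%:R / (n.+1%:R + alpha)))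
   (fun n => gamma_ratio s n * (1 + s / n.+1%:R))).
- by near=> n; exact: gamma_ratio_step.
- rewrite -[X in _ --> X](mulr1 1); apply: cvgM => //.
  have -> : (fun n : nat => (n.+1%:R / (n.+1%:R + alpha) : R)) = (fun n : nat => (1 + alpha * n.+1%:R^-1)^-1).
    apply/funext => n; have n0 : 0 < n.+1%:R :> R by rewrite ltr0n.
    have n1 : 0 < n.+1%:R + alpha by rewrite addr_gt0.
    rewrite -[LHS]invrK invf_div mulrDl divff ?gt_eqF//.
  rewrite -[X in _ --> X]invr1; apply: cvgV; first exact: oner_neq0.
  exact: cvg1D.
- by rewrite -[X in _ --> X](mulr1 1); apply: cvgM => //; exact: cvg1D.
Unshelve. all: by end_near.
Qed.

End gamma_quotients.

Local Open Scope complex_scope.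

(** * Real and imaginary parts, and the modulus *)

Section complex_aux.
Context {R : realType}.
Implicit Types z : R[i].

Lemma Re_mulc z1 z2 : complex.Re (z1 * z2) =
  complex.Re z1 * complex.Re z2 - complex.Im z1 * complex.Im z2.
Proof. by case: z1 => a b; case: z2. Qed.

Lemma Im_mulc z1 z2 : complex.Im (z1 * z2) =
  complex.Re z1 * complex.Im z2 + complex.Im z1 * complex.Re z2.
Proof. by case: z1 => a b; case: z2. Qed.

Lemma normc_ge0 z : 0 <= normc z.
Proof. by case: z => a b; exact: sqrtr_ge0. Qed.

Lemma ler_Re_normc z : `|complex.Re z| <= normc z.
Proof.
by case: z => a b /=; rewrite -sqrtr_sqr ler_sqrt ?lerDl ?sqr_ge0// addr_ge0// sqr_ge0.
Qed.

Lemma ler_Im_normc z : `|complex.Im z| <= normc z.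
Proof.
by case: z => a b /=; rewrite -sqrtr_sqr ler_sqrt ?lerDr ?sqr_ge0// addr_ge0// sqr_ge0.
Qed.

Lemma normc_real (a : R) : normc a%:C = `|a|.
Proof. by rewrite /= expr0n/= addr0 sqrtr_sqr. Qed.

Lemma normc_imag (a : R) : normc (0 +i* a) = `|a|.
Proof. by rewrite /= expr0n/= add0r sqrtr_sqr. Qed.

Lemma normcX z n : normc (z ^+ n) = normc z ^+ n.
Proof. by elim: n => [|n IH]; rewrite ?expr0 ?normc1// !exprS normcM IH. Qed.

Lemma ler_normc_sum n (F : nat -> R[i]) :
  normc (\sum_(k < n) F k) <= \sum_(k < n) normc (F k).
Proof.
elim: n => [|n IH]; first by rewrite !big_ord0 normc0.
by rewrite !big_ord_recr/=; apply: le_trans (le_normcD _ _) _; rewrite lerD2r.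
Qed.

Lemma Re_sumc n (F : nat -> R[i]) :
  complex.Re (\sum_(k < n) F k) = \sum_(k < n) complex.Re (F k).
Proof. by elim: n => [|n IH]; rewrite ?big_ord0// !big_ord_recr/= -IH; case: (\sum_(i < n) _) => a b; case: (F n). Qed.

Lemma Im_sumc n (F : nat -> R[i]) :
  complex.Im (\sum_(k < n) F k) = \sum_(k < n) complex.Im (F k).
Proof. by elim: n => [|n IH]; rewrite ?big_ord0// !big_ord_recr/= -IH; case: (\sum_(i < n) _) => a b; case: (F n). Qed.

(** Convergence is stated on real and imaginary parts because this is how the
    sum of a complex series is defined. *)
Lemma normc_lim_le (a b B : R^nat) la lb lB :
  a @ \oo --> la -> b @ \oo --> lb -> B @ \oo --> lB ->
  (forall n, normc (a n +i* b n) <= B n) -> normc (la +i* lb) <= lB.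
Proof.
move=> ha hb hB h.
have hn : (fun n => normc (a n +i* b n)) @ \oo --> normc (la +i* lb).
  apply: (@cvg_comp _ _ _ (fun n => a n ^+ 2 + b n ^+ 2) (@Num.sqrt R) _ (nbhs (la ^+ 2 + lb ^+ 2))).
    by rewrite !expr2; apply: cvgD; under eq_fun do rewrite expr2; exact: cvgM.
  exact: sqrt_continuous.
by apply: (ler_cvg_to hn hB); apply: nearW.
Qed.

End complex_aux.

(** * A discrete fractional equation *)

Section discrete.
Context {R : realType}.
Variables (alpha mu : R) (M : nat).
Hypothesis ha : 0 < alpha < 1.

Let w : R[i] := 0 +i* mu.
(** The coefficient of z^n in 1 / ((1 - z)^alpha - i mu), expanded in powers of
    mu and truncated to M terms. *)
Definition discrete_ml (n : nat) : R[i] :=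
  \sum_(m < M) w ^+ m * (risecoef (alpha * m.+1%:R) n)%:C.
Let Y := discrete_ml.
(** The first term is the solution of the scheme for mu = 0; the second one pays
    for the truncation. *)
Definition discrete_bound (n : nat) : R :=
  risecoef alpha n + `|mu| ^+ M * risecoef (alpha * M.+1%:R) n.
Let W := discrete_bound.

(** Multiplying the truncated expansion by (1 - z)^alpha - i mu telescopes: only
    the constant 1 and the term of order M remain. *)
Let Y_rec n : (1 - w) * Y n = (risecoef 0 n)%:C - w ^+ M * (risecoef (alpha * M%:R) n)%:C -
  \sum_(k < n) (risecoef (- alpha) k.+1)%:C * Y (n - k.+1).
Proof.
(* convolution with the coefficients of (1 - z)^alpha lowers every exponent by alpha *)
have e1 : \sum_(k < n.+1) (risecoef (- alpha) k)%:C * Y (n - k) =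
    \sum_(m < M) w ^+ m * (risecoef (alpha * m%:R) n)%:C.
  rewrite /Y /discrete_ml; under eq_bigr do rewrite mulr_sumr.
  rewrite exchange_big/=; apply: eq_bigr => m _.
  under eq_bigr => k _ do rewrite mulrCA -rmorphM/=.
  rewrite -mulr_sumr -rmorph_sum/= risecoef_conv -natr1.
  by congr (_ * (risecoef _ _)%:C); ring.
have e2 : \sum_(m < M) w ^+ m * (risecoef (alpha * m%:R) n)%:C + w ^+ M * (risecoef (alpha * M%:R) n)%:C
    = (risecoef 0 n)%:C + w * Y n.
  transitivity (\sum_(m < M.+1) w ^+ m * (risecoef (alpha * m%:R) n)%:C).
    by rewrite big_ord_recr.
  rewrite big_ord_recl/= mulr0 expr0 mul1r; congr (_ + _).
  rewrite /Y /discrete_ml mulr_sumr; apply: eq_bigr => m _.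
  by rewrite /bump leq0n add1n exprS mulrA.
rewrite mulrBl mul1r -[w * Y n](addKr (risecoef 0 n)%:C) -e2 -e1.
rewrite big_ord_recl/= subn0 risecoef0 mul1r.
by rewrite /bump/=; under eq_bigr do rewrite add1n; ring.
Qed.

Let W_rec n : W n = risecoef 0 n + `|mu| ^+ M * risecoef (alpha * M%:R) n -
  \sum_(k < n) risecoef (- alpha) k.+1 * W (n - k.+1).
Proof.
suff : \sum_(k < n.+1) risecoef (- alpha) k * W (n - k) =
    risecoef 0 n + `|mu| ^+ M * risecoef (alpha * M%:R) n.
  move=> <-; rewrite big_ord_recl/= subn0 risecoef0 mul1r.
  by rewrite /bump/=; under [X in _ + X - _]eq_bigr do rewrite add1n; ring.
rewrite /W /discrete_bound; under eq_bigr do rewrite mulrDr.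
rewrite big_split/= risecoef_conv addNr; congr (_ + _).
under eq_bigr do rewrite mulrCA.
rewrite -mulr_sumr risecoef_conv; congr (_ * risecoef _ _).
by rewrite -natr1; ring.
Qed.

(** The recurrence for the modulus of discrete_ml has nonnegative weights and a
    left-hand factor of modulus at least 1, so that the solution of the
    corresponding recurrence with absolute values dominates. *)
Lemma discrete_ml_le n : normc (discrete_ml n) <= discrete_bound n.
Proof.
rewrite -/Y -/W.
have [N] := ubnP n; elim: N n => // N IH n; rewrite ltnS => nN.
have a0 : 0 <= alpha by case/andP: ha => /ltW.
have w1 : 1 <= normc (1 - w).
  have := ler_Re_normc (1 - w); rewrite /w/= subr0 normr1; exact.
apply: (@le_trans _ _ (normc ((1 - w) * Y n))).
  by rewrite normcM ler_peMl// normc_ge0.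
rewrite Y_rec W_rec -[in leRHS]sumrN.
apply: le_trans (le_normcD _ _) _; rewrite normcN.
have c0 m s : 0 <= s -> normc ((risecoef s m)%:C : R[i]) = risecoef s m.
  by move=> s0; rewrite normc_real ger0_norm// risecoef_ge0.
apply: lerD.
  apply: le_trans (le_normcD _ _) _.
  by rewrite normcN normcM normcX normc_imag !c0// mulr_ge0.
apply: le_trans (ler_normc_sum n (fun k => (risecoef (- alpha) k.+1)%:C * Y (n - k.+1))) _.
apply: ler_sum => k _.
rewrite normcM normc_real ler0_norm; last by rewrite risecoef_le0//; move: ha; lra.
rewrite -mulNr ler_wpM2l ?oppr_ge0 ?risecoef_le0//; first by move: ha; lra.
apply: IH; apply: leq_trans nN.
by rewrite ltn_subrL/= (leq_ltn_trans _ (ltn_ord k)).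
Qed.

End discrete.

(** * The Mittag-Leffler function on the imaginary axis *)

Section ml_bound.
Context {R : realType}.
Variable alpha : R.
Hypothesis ha : 0 < alpha < 1.
Implicit Types x : R.

Let a0 : 0 < alpha. Proof. by case/andP: ha. Qed.

Let am_gt0 (m : nat) : 0 < alpha * m.+1%:R. Proof. by rewrite mulr_gt0. Qed.

Lemma risecoef_gamma_ratio (m n : nat) :
  n.+1%:R / n.+1%:R `^ alpha * ((n.+1%:R `^ alpha)^-1 ^+ m * risecoef (alpha * m.+1%:R) n.+1) =
  gamma_ratio (alpha * m.+1%:R) n / Gamma (alpha * m.+1%:R).
Proof.
rewrite /gamma_ratio Gamma_risecoef// factS natrM.
have f0 : n`!%:R != 0 :> R by rewrite gt_eqF// ltr0n fact_gt0.
have N0 : n.+1%:R != 0 :> R by rewrite pnatr_eq0.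
have G0 : Gamma (alpha * m.+1%:R) != 0 by rewrite gt_eqF// Gamma_gt0.
have p0 : n.+1%:R `^ alpha != 0 by rewrite gt_eqF// powR_gt0.
rewrite powRrM powR_mulrn ?powR_ge0// exprS exprVn.
move: (n.+1%:R `^ alpha) p0 => p p0; have pm0 : p ^+ m != 0 by rewrite expf_neq0.
move: (n.+1%:R : R) N0 => N N0.
by field; rewrite ?p0 ?f0 ?G0 ?N0 ?pm0.
Qed.

(** This is discrete_ml_le at time N = n + 1 for mu = x / N^alpha, multiplied by
    N^(1 - alpha). *)
Lemma ml_gamma_ratio_le x (M n : nat) :
  normc (\sum_(m < M) (0 +i* x) ^+ m * (gamma_ratio (alpha * m.+1%:R) n / Gamma (alpha * m.+1%:R))%:C) <=
  gamma_ratio (alpha * 1%:R) n / Gamma (alpha * 1%:R) +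
  `|x| ^+ M * (gamma_ratio (alpha * M.+1%:R) n / Gamma (alpha * M.+1%:R)).
Proof.
set q := (n.+1%:R `^ alpha)^-1 : R.
set c : R := n.+1%:R / n.+1%:R `^ alpha.
have q0 : 0 <= q by rewrite invr_ge0 powR_ge0.
have c0 : 0 <= c by rewrite divr_ge0// powR_ge0.
have := @discrete_ml_le R alpha (x * q) M ha n.+1.
move=> /(ler_wpM2l c0).
have nc : normc (c%:C : R[i]) = c by rewrite normc_real ger0_norm.
rewrite -{1}nc -normcM /discrete_ml /discrete_bound.
rewrite mulrDr mulr_sumr.
rewrite -!risecoef_gamma_ratio expr0 mul1r mulr1 normrM exprMn (ger0_norm q0).
rewrite -/q -/c; congr (normc _ <= _ + _).
  apply: eq_bigr => m _.
  rewrite -risecoef_gamma_ratio -/q -/c !rmorphM/= rmorphXn/=.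
  have -> : (0 +i* (x * q) : R[i]) = (0 +i* x) * q%:C.
    by apply/eqP; rewrite eq_complex/= !mul0r !mulr0 subr0 add0r !eqxx.
  by rewrite exprMn; ring.
by ring.
Qed.

Definition ml_coef x (m : nat) : R := `|x| ^+ m / Gamma (alpha * m%:R + alpha).

Let amS (m : nat) : alpha * m%:R + alpha = alpha * m.+1%:R.
Proof. by rewrite -natr1; ring. Qed.

Lemma ml_coef_ge0 x m : 0 <= ml_coef x m.
Proof. by rewrite /ml_coef amS divr_ge0// ltW// Gamma_gt0. Qed.

(** Consecutive terms have a ratio of order m^(- alpha) by GammaD_ge, so that
    the series converges for every x. *)
Lemma ml_coef_step x (m : nat) :
  ml_coef x m.+1 <= ml_coef x m * (2 * `|x| / (alpha * m.+1%:R) `^ alpha).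
Proof.
rewrite /ml_coef !amS.
set s := alpha * m.+1%:R.
have s0 : 0 < s by exact: am_gt0.
have -> : alpha * m.+2%:R = s + alpha by rewrite /s -[m.+2%:R]natr1; ring.
have sa : alpha <= s by rewrite /s ler_peMr ?ler1n// ltW.
have G0 := Gamma_gt0 _ s0.
have G1 : 0 < Gamma (s + alpha) by rewrite Gamma_gt0// addr_gt0.
have p0 : 0 < s `^ alpha by rewrite powR_gt0.
rewrite ler_pdivrMr// exprS.
have -> : `|x| ^+ m / Gamma s * (2 * `|x| / s `^ alpha) * Gamma (s + alpha) =
  (`|x| * `|x| ^+ m) * (2 / (s `^ alpha * Gamma s) * Gamma (s + alpha)).
  by field; rewrite !gt_eqF.
rewrite ler_peMr ?mulr_ge0//.
rewrite mulrAC ler_pdivlMr ?mulr_gt0// mul1r.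
apply: (@le_trans _ _ (2 * (s `^ alpha * (s / (s + alpha)) * Gamma s))); last first.
  by rewrite ler_pM2l// GammaD_ge.
have -> : 2 * (s `^ alpha * (s / (s + alpha)) * Gamma s) = s `^ alpha * Gamma s * (2 * (s / (s + alpha))) by ring.
rewrite ler_peMr ?mulr_ge0 ?(ltW p0) ?(ltW G0)//.
by rewrite mulrA ler_pdivlMr ?addr_gt0//; lra.
Qed.

Lemma is_cvg_ml_coef x : cvgn (series (ml_coef x)).
Proof.
(* from m0 on, the ratio of consecutive terms is at most 1/2 *)
pose m0 : nat := Num.truncn ((4 * `|x|) `^ alpha^-1 / alpha).
have half (m : nat) : (m0 <= m)%N -> ml_coef x m.+1 <= ml_coef x m * 2^-1.
  move=> mm; apply: le_trans (ml_coef_step _ _) _; rewrite ler_wpM2l ?ml_coef_ge0//.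
  have p0 : 0 < (alpha * m.+1%:R) `^ alpha by rewrite powR_gt0.
  rewrite ler_pdivrMr//.
  suff : 4 * `|x| <= (alpha * m.+1%:R) `^ alpha by lra.
  have e : ((4 * `|x|) `^ alpha^-1) `^ alpha = 4 * `|x|.
    by rewrite -powRrM mulVf ?gt_eqF// powRr1// mulr_ge0.
  rewrite -[leLHS]e ge0_ler_powR ?nnegrE ?powR_ge0 ?(ltW a0) ?(ltW (am_gt0 _))//.
  rewrite [alpha * _]mulrC -ler_pdivrMr// ltW//; apply: lt_le_trans (truncnS_gt _) _.
  by rewrite ler_nat ltnS.
(* K bounds ml_coef x m * 2^m for m <= m0, hence for all m *)
pose K := \sum_(j < m0.+1) ml_coef x j * 2 ^+ j.
have term_ge0 j : 0 <= ml_coef x j * 2 ^+ j by rewrite mulr_ge0// ml_coef_ge0.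
have K0 : 0 <= K by apply: sumr_ge0 => j _.
have bound m : ml_coef x m <= geometric K 2^-1 m.
  rewrite /geometric/= exprVn ler_pdivlMr ?exprn_gt0//.
  elim: m => [|m IH].
    by rewrite /K big_ord_recl lerDl; apply: sumr_ge0 => j _.
  have [mm|mm] := leqP m0 m.
    apply: le_trans IH; rewrite exprS mulrA ler_wpM2r ?exprn_ge0//.
    by have := half m mm; lra.
  rewrite /K (bigD1 (Ordinal (mm : (m.+1 < m0.+1)%N)))//= lerDl.
  by apply: sumr_ge0 => j _.
apply: (series_le_cvg (ml_coef_ge0 x) _ bound).
  by move=> n; rewrite mulr_ge0 ?exprn_ge0.
by apply: is_cvg_geometric_series; rewrite ger0_norm// invf_lt1// ltr1n.
Qed.

Definition ml_term x (m : nat) : R[i] :=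
  (0 +i* x) ^+ m / (Gamma (alpha * m%:R + alpha))%:C.

Lemma normc_ml_term x m : normc (ml_term x m) = ml_coef x m.
Proof.
rewrite /ml_term normcM normcX normc_imag normcV normc_real /ml_coef amS.
by rewrite [X in _ / X]ger0_norm// ltW// Gamma_gt0.
Qed.

Lemma is_cvg_Re_ml x : cvgn (series (fun m => complex.Re (ml_term x m))).
Proof.
apply: normed_cvg; apply: series_le_cvg (is_cvg_ml_coef x) => [n|n|n].
- exact: normr_ge0.
- exact: ml_coef_ge0.
- by rewrite -normc_ml_term ler_Re_normc.
Qed.

Lemma is_cvg_Im_ml x : cvgn (series (fun m => complex.Im (ml_term x m))).
Proof.
apply: normed_cvg; apply: series_le_cvg (is_cvg_ml_coef x) => [n|n|n].
- exact: normr_ge0.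
- exact: ml_coef_ge0.
- by rewrite -normc_ml_term ler_Im_normc.
Qed.

(** The bound on the discrete scheme as the step 1 / N tends to 0, for a fixed
    number M of terms. *)
Lemma normc_ml_partial_le x (M : nat) :
  normc (series (fun m => complex.Re (ml_term x m)) M +i*
         series (fun m => complex.Im (ml_term x m)) M) <=
  (Gamma alpha)^-1 + ml_coef x M.
Proof.
pose F n m := (0 +i* x) ^+ m * (gamma_ratio (alpha * m.+1%:R) n / Gamma (alpha * m.+1%:R))%:C.
have hratio m (c : R) : c * (gamma_ratio (alpha * m.+1%:R) n / Gamma (alpha * m.+1%:R)) @[n --> \oo] -->
    c / Gamma (alpha * m%:R + alpha).
  rewrite amS; apply: cvgMl_tmp; rewrite -[X in _ --> X]mul1r.
  by apply: cvgMr_tmp; exact: gamma_ratio_cvg.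
have FE n m : F n m = ((0 +i* x) ^+ m) * (gamma_ratio (alpha * m.+1%:R) n / Gamma (alpha * m.+1%:R))%:C by [].
have cvg_sum (G : nat -> nat -> R) (L : nat -> R) : (forall m, G n m @[n --> \oo] --> L m) ->
    (\sum_(m < M) G n m) @[n --> \oo] --> series L M.
  move=> h; rewrite /series/= big_mkord; elim: M => [|M' IH].
    by under eq_fun do rewrite big_ord0; rewrite big_ord0; exact: cvg_cst.
  under eq_fun do rewrite big_ord_recr/=.
  by rewrite big_ord_recr/=; exact: cvgD IH (h M').
apply: (@normc_lim_le _ (fun n => complex.Re (\sum_(m < M) F n m))
  (fun n => complex.Im (\sum_(m < M) F n m)) (fun n => 1 * (gamma_ratio (alpha * 1%:R) n / Gamma (alpha * 1%:R)) +
  `|x| ^+ M * (gamma_ratio (alpha * M.+1%:R) n / Gamma (alpha * M.+1%:R)))).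
- under eq_fun do rewrite Re_sumc.
  apply: (cvg_sum (fun n m => complex.Re (F n m)) (fun m => complex.Re (ml_term x m))) => m; under eq_fun do rewrite FE Re_mulc/= mulr0 subr0.
  by rewrite /ml_term -fmorphV Re_mulc/= mulr0 subr0; exact: hratio.
- under eq_fun do rewrite Im_sumc.
  apply: (cvg_sum (fun n m => complex.Im (F n m)) (fun m => complex.Im (ml_term x m))) => m; under eq_fun do rewrite FE Im_mulc/= mulr0 add0r.
  by rewrite /ml_term -fmorphV Im_mulc/= mulr0 add0r; exact: hratio.
- apply: cvgD; last exact: hratio.
  have -> : (Gamma alpha)^-1 = 1 / Gamma (alpha * 0%:R + alpha) by rewrite mulr0 add0r mul1r.
  exact: hratio.
- move=> n; rewrite mul1r.
  have := ml_gamma_ratio_le x M n; rewrite -/(F n).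
  by case: (\sum_(m < M) F n m).
Qed.

(** At x = 0 this is an equality. The last term in normc_ml_partial_le tends to
    0 as M grows, being the general term of a convergent series. *)
Lemma normc_mittag_leffler_le x :
  normc (mittag_leffler alpha alpha (0 +i* x)) <= (Gamma alpha)^-1.
Proof.
apply: (@normc_lim_le R _ _ (fun M => (Gamma alpha)^-1 + ml_coef x M) _ _ _
  (is_cvg_Re_ml x) (is_cvg_Im_ml x) _ (normc_ml_partial_le x)).
rewrite -[X in _ --> X]addr0; apply: cvgD; first exact: cvg_cst.
exact: cvg_series_cvg_0 (is_cvg_ml_coef x).
Qed.

(** A pointwise limit of polynomials in x. *)
Lemma measurable_mittag_leffler :
  cmeasurable_fun setT (fun x => mittag_leffler alpha alpha (0 +i* x)).
Proof.
have E x m : ml_term x m = (0 +i* 1) ^+ m * (x ^+ m / Gamma (alpha * m%:R + alpha))%:C.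
  rewrite /ml_term; have -> : (0 +i* x : R[i]) = (0 +i* 1) * x%:C.
    by apply/eqP; rewrite eq_complex/= !mul0r !mulr0 mul1r subr0 add0r !eqxx.
  by rewrite exprMn rmorphM/= rmorphXn/= fmorphV mulrA.
have mX (c b : R) m : measurable_fun [set: R] (fun x => c * (x ^+ m / b)).
  by apply: measurable_funM => //; apply: measurable_funM => //; exact: measurable_funX.
split.
- apply: (@measurable_fun_cvg _ _ _ _ (fun M x => series (fun m => complex.Re (ml_term x m)) M)).
    move=> M; apply: measurable_sum => m.
    by under eq_fun do rewrite E Re_mulc/= mulr0 subr0; exact: mX.
  by move=> x _; exact: is_cvg_Re_ml.
- apply: (@measurable_fun_cvg _ _ _ _ (fun M x => series (fun m => complex.Im (ml_term x m)) M)).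
    move=> M; apply: measurable_sum => m.
    by under eq_fun do rewrite E Im_mulc/= mulr0 add0r; exact: mX.
  by move=> x _; exact: is_cvg_Im_ml.
Qed.

End ml_bound.

(** * Lebesgue measure on row vectors *)

Section lebesgue_rV_facts.
Context {R : realType} {d : nat}.
Implicit Types G : set 'rV[R]_d.

(** An open set is the countable union of the boxes with rational corners that
    it contains. *)
Lemma open_measurable_rV G : open G -> measurable G.
Proof.
move=> oG.
pose B (q : 'rV[rat]_d * 'rV[rat]_d) : set 'rV[R]_d := box (map_mx ratr q.1, map_mx ratr q.2).
pose C q := if pselect (B q `<=` G) then B q else set0.
have -> : G = \bigcup_q C q.
  apply/seteqP; split => [x Gx|x [q _]]; last first.
    by rewrite /C; case: pselect => // BG; exact: BG.
  have /nbhs_ballP[/= r r0 rG] : nbhs x G by exact: open_nbhs_nbhs.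
  have lo i : {p : rat | ratr p \in `]x 0 i - r, x 0 i[%R}.
    apply/cid; apply: rat_in_itvoo; by rewrite ltrBlDr ltrDl.
  have hi i : {p : rat | ratr p \in `]x 0 i, x 0 i + r[%R}.
    apply/cid; apply: rat_in_itvoo; by rewrite ltrDl.
  pose q : 'rV[rat]_d * 'rV[rat]_d := (\row_i sval (lo i), \row_i sval (hi i)).
  exists q => //; rewrite /C; case: pselect => [_ i|]/=.
    rewrite !mxE; have := svalP (lo i); have := svalP (hi i).
    by rewrite /= !in_itv/= => /andP[/ltW -> _] /andP[_ ->].
  case=> y Bqy; apply: rG; split => // i j; rewrite (ord1 i).
  have := Bqy j; rewrite /= !mxE; have := svalP (lo j); have := svalP (hi j).
  rewrite /= !in_itv/= => /andP[_ h1] /andP[h2 _] /andP[h3 h4].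
  by rewrite /ball/= ltr_distlC; apply/andP; split; [exact: lt_trans h3|exact: le_lt_trans h1].
have mC q : measurable (C q).
  by rewrite /C; case: pselect => h; [exact: measurable_box|exact: measurable0].
have cq : countable [set: 'rV[rat]_d * 'rV[rat]_d] by exact: countableP.
exact: (@countable_bigcupT_measurable _ 'rV[R]_d _ C cq mC).
Qed.

Lemma bounded_lebesgue_rV G : bounded_set G -> (lebesgue_rV G < +oo)%E.
Proof.
move=> [M [_ hM]].
apply: (@le_lt_trans _ _ (lebesgue_rV (box (const_mx (- (`|M| + 2)), const_mx (`|M| + 2)) : set 'rV[R]_d))).
  apply: le_lebesgue_outer => x Gx i; rewrite /= !mxE.
  have h : `|x| <= `|M| + 1 by apply: hM => //; have := ler_norm M; lra.
  have xi : `|x 0 i| <= `|x| by rewrite [leRHS]/Num.norm/= mx_normrE; apply: le_bigmax (0, i).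
  have := le_trans xi h; rewrite ler_norml => /andP[h1 h2].
  by apply/andP; split; lra.
by apply: le_lt_trans (lebesgue_outer_obox (Some _)) _; exact: ltry.
Qed.

End lebesgue_rV_facts.

Set Implicit Arguments.
Unset Strict Implicit.

(** * Integration of complex-valued functions *)

Section complex_integration.
Context {R : realType} {disp : measure_display} {X : measurableType disp}.
Variables (mu : {measure set X -> \bar R}) (D : set X).
Hypothesis mD : measurable D.
Implicit Types f g h : X -> R[i].

Lemma cmeasurable_funD f g : cmeasurable_fun D f -> cmeasurable_fun D g ->
  cmeasurable_fun D (fun x => f x + g x).
Proof.
move=> [f1 f2] [g1 g2]; split.
- apply: eq_measurable_fun (measurable_funD f1 g1) => x _ /=.
  by case: (f x) => a b; case: (g x).
- apply: eq_measurable_fun (measurable_funD f2 g2) => x _ /=.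
  by case: (f x) => a b; case: (g x).
Qed.

Lemma cmeasurable_funM f g : cmeasurable_fun D f -> cmeasurable_fun D g ->
  cmeasurable_fun D (fun x => f x * g x).
Proof.
move=> [f1 f2] [g1 g2]; split.
- under eq_fun do rewrite Re_mulc.
  by apply: measurable_funB; apply: measurable_funM.
- under eq_fun do rewrite Im_mulc.
  by apply: measurable_funD; apply: measurable_funM.
Qed.

Lemma cmeasurable_cst (c : R[i]) : cmeasurable_fun D (fun=> c).
Proof. by split; exact: measurable_cst. Qed.

Lemma cmeasurable_conjc f : cmeasurable_fun D f -> cmeasurable_fun D (fun x => conjc (f x)).
Proof.
move=> [f1 f2]; split.
- by apply: eq_measurable_fun f1 => x _ /=; case: (f x).
- apply: (@eq_measurable_fun _ _ _ _ _ (fun x => - complex.Im (f x))) => [x _ /=|].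
    by case: (f x).
  exact: measurableT_comp.
Qed.

Lemma measurable_normc f : cmeasurable_fun D f -> measurable_fun D (fun x => normc (f x)).
Proof.
move=> [f1 f2].
apply: (@eq_measurable_fun _ _ _ _ _
  (fun x => Num.sqrt (complex.Re (f x) ^+ 2 + complex.Im (f x) ^+ 2))) => [x _|].
  by rewrite /normc; case: (f x).
apply: (@measurableT_comp _ _ _ _ _ _ (@Num.sqrt R)).
  by apply: continuous_measurable_fun; exact: sqrt_continuous.
by apply: measurable_funD; exact: measurable_funX.
Qed.

Definition cintegrable f : Prop :=
  mu.-integrable D (EFin \o (fun x => complex.Re (f x))) /\
  mu.-integrable D (EFin \o (fun x => complex.Im (f x))).

Lemma le_cintegrable f (b : X -> R) : cmeasurable_fun D f ->
  mu.-integrable D (EFin \o b) -> (forall x, D x -> normc (f x) <= b x) -> cintegrable f.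
Proof.
move=> [f1 f2] ib fb; split.
- apply: (le_integrable mD _ _ ib); first exact/measurable_EFinP.
  move=> x Dx /=; rewrite lee_fin (ger0_norm (le_trans (normc_ge0 _) (fb _ Dx))).
  exact: le_trans (ler_Re_normc _) (fb _ Dx).
- apply: (le_integrable mD _ _ ib); first exact/measurable_EFinP.
  move=> x Dx /=; rewrite lee_fin (ger0_norm (le_trans (normc_ge0 _) (fb _ Dx))).
  exact: le_trans (ler_Im_normc _) (fb _ Dx).
Qed.

Lemma cintegralD f g : cintegrable f -> cintegrable g ->
  cintegral mu D (fun x => f x + g x) = cintegral mu D f + cintegral mu D g.
Proof.
move=> [f1 f2] [g1 g2]; rewrite /cintegral; apply/eqP; rewrite eq_complex/=.
rewrite -!RintegralD//; apply/andP; split; apply/eqP; apply: eq_Rintegral => x _;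
  by case: (f x) => a b; case: (g x).
Qed.

Let iZ (c : R) (u : X -> R) : mu.-integrable D (EFin \o u) ->
  mu.-integrable D (EFin \o (fun x => c * u x)).
Proof.
by move=> iu; rewrite (_ : _ \o _ = (fun x => c%:E * (EFin \o u) x)%E)//; exact: integrableZl.
Qed.

Lemma cintegralZl (c : R[i]) f : cintegrable f ->
  cintegral mu D (fun x => c * f x) = c * cintegral mu D f.
Proof.
move=> [f1 f2]; rewrite /cintegral; apply/eqP; rewrite eq_complex Re_mulc Im_mulc/=.
rewrite -!RintegralZl// -RintegralB ?iZ// -RintegralD ?iZ//.
by apply/andP; split; apply/eqP; apply: eq_Rintegral => x _; rewrite ?Re_mulc ?Im_mulc.
Qed.

End complex_integration.

(** * Square-integrable functions *)

Section square_integrable.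
Context {R : realType} {disp : measure_display} {X : measurableType disp}.
Variables (mu : {measure set X -> \bar R}) (D : set X).
Hypothesis mD : measurable D.
Implicit Types f g h : X -> R[i].

(** Equivalent to membership in L^2, but phrased with the integral of the squared
    modulus, which is what linearity and domination arguments use. *)
Definition csqint f : Prop := cmeasurable_fun D f /\
  mu.-integrable D (EFin \o (fun x => normc (f x) ^+ 2)).

Definition cinner f g : R[i] := cintegral mu D (fun x => f x * conjc (g x)).

Lemma cLnorm2_sqr f : (cLnorm mu D 2%:E f `^ 2 =
  \int[mu]_(x in D) (normc (f x) ^+ 2)%:E)%E.
Proof.
rewrite /cLnorm powR_Lnorm// [RHS]integral_mkcond; apply: eq_integral => x _.
rewrite !restrict_EFin /= !patchE; case: ifPn => _.
  by rewrite ger0_norm ?normc_ge0// -powR_mulrn ?normc_ge0.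
by rewrite (_ : point = 0 :> R)// normr0 powR0.
Qed.

Lemma in_L2_csqint f : cmeasurable_fun D f -> (cLnorm mu D 2%:E f < +oo)%E -> csqint f.
Proof.
move=> mf foo; split => //; apply/integrableP; split.
  apply/measurable_EFinP; apply: measurable_funX; exact: measurable_normc.
under eq_integral do rewrite gee0_abs ?lee_fin ?sqr_ge0//.
rewrite -cLnorm2_sqr; apply: poweR_lty; exact: foo.
Qed.

Lemma csqintD f g : csqint f -> csqint g -> csqint (fun x => f x + g x).
Proof.
move=> [mf fi] [mg gi]; have mfg := cmeasurable_funD mf mg; split => //.
have i := integrableZl mD 2 (integrableD mD fi gi).
apply: (le_integrable mD _ _ i).
  by apply/measurable_EFinP; apply: measurable_funX; exact: measurable_normc.
move=> x Dx; rewrite /= lee_fin (ger0_norm (sqr_ge0 _)).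
apply: le_trans (ler_norm _).
have h := le_normcD (f x) (g x).
have h0 := normc_ge0 (f x + g x).
move: (normc (f x + g x)) (normc (f x)) (normc (g x)) h h0 => a b c h h0.
(* a^2 <= (b + c)^2 <= 2 (b^2 + c^2) *)
have p : 0 <= (b + c - a) * (b + c + a) by rewrite mulr_ge0//; lra.
by have := sqr_ge0 (b - c); nra.
Qed.

Lemma csqintZ (c : R[i]) f : csqint f -> csqint (fun x => c * f x).
Proof.
move=> [mf fi]; split.
  by apply: cmeasurable_funM => //; exact: cmeasurable_cst.
have := integrableZl mD (normc c ^+ 2) fi.
by apply: eq_integrable => // x _; rewrite /= normcM exprMn.
Qed.

Lemma csqint0 : csqint (fun=> 0).
Proof.
split; first exact: cmeasurable_cst.
have := @integrable0 _ _ R mu D.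
by apply: eq_integrable => // x _; rewrite /comp normc0 expr0n.
Qed.

Lemma csqint_sum (I : Type) (r : seq I) (F : I -> X -> R[i]) :
  (forall i, csqint (F i)) -> csqint (fun x => \sum_(i <- r) F i x).
Proof.
move=> sF; elim: r => [|i r IH].
  by under eq_fun do rewrite big_nil; exact: csqint0.
by under eq_fun do rewrite big_cons; exact: csqintD.
Qed.

Lemma normc_conjc (z : R[i]) : normc (conjc z) = normc z.
Proof. by case: z => a b /=; rewrite sqrrN. Qed.

(** |f g| <= |f|^2 + |g|^2. *)
Lemma csqint_mul f g : csqint f -> csqint g -> cintegrable mu D (fun x => f x * conjc (g x)).
Proof.
move=> [mf fi] [mg gi].
apply: (@le_cintegrable _ _ _ _ _ mD _ (fun x => normc (f x) ^+ 2 + normc (g x) ^+ 2)).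
- by apply: cmeasurable_funM => //; exact: cmeasurable_conjc.
- exact: (integrableD mD fi gi).
- move=> x Dx; rewrite normcM normc_conjc.
  have := sqr_ge0 (normc (f x) - normc (g x)).
  have := mulr_ge0 (normc_ge0 (f x)) (normc_ge0 (g x)).
  by nra.
Qed.

Lemma cinnerD f g h : csqint f -> csqint g -> csqint h ->
  cinner (fun x => f x + g x) h = cinner f h + cinner g h.
Proof.
move=> sf sg sh; rewrite /cinner -cintegralD//; try exact: csqint_mul.
by congr cintegral; apply/funext => x; rewrite mulrDl.
Qed.

Lemma cinnerZ (c : R[i]) f h : csqint f -> csqint h ->
  cinner (fun x => c * f x) h = c * cinner f h.
Proof.
move=> sf sh; rewrite /cinner -cintegralZl//; try exact: csqint_mul.
by congr cintegral; apply/funext => x; rewrite mulrA.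
Qed.

Lemma cinner0 h : cinner (fun=> 0) h = 0.
Proof.
rewrite /cinner /cintegral; apply/eqP; rewrite eq_complex/=.
under eq_Rintegral do rewrite mul0r/=.
under [X in _ && (X == _)]eq_Rintegral do rewrite mul0r/=.
by rewrite /Rintegral integral0 eqxx.
Qed.

Lemma cinner_sum (I : Type) (r : seq I) (F : I -> X -> R[i]) h :
  (forall i, csqint (F i)) -> csqint h ->
  cinner (fun x => \sum_(i <- r) F i x) h = \sum_(i <- r) cinner (F i) h.
Proof.
move=> sF sh; elim: r => [|i r IH].
  by rewrite big_nil -[RHS](cinner0 h); under eq_fun do rewrite big_nil.
rewrite big_cons -IH -cinnerD//; last exact: csqint_sum.
by congr cinner; apply/funext => x; rewrite big_cons.
Qed.

Lemma cauchy_schwarz f g : cmeasurable_fun D f -> cmeasurable_fun D g ->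
  (\int[mu]_(x in D) (normc (f x) * normc (g x))%:E <=
    cLnorm mu D 2%:E f * cLnorm mu D 2%:E g)%E.
Proof.
move=> mf mg.
pose F := (fun x => normc (f x)) \_ D; pose G := (fun x => normc (g x)) \_ D.
have mF : measurable_fun setT F by apply/(measurable_restrictT _ mD); exact: measurable_normc.
have mG : measurable_fun setT G by apply/(measurable_restrictT _ mD); exact: measurable_normc.
have := @hoelder _ _ _ mu F G 2 2 mF mG (ltr0Sn _ _) (ltr0Sn _ _).
have -> : 2^-1 + 2^-1 = 1 :> R by lra.
move=> /(_ erefl); rewrite Lnorm1.
rewrite /cLnorm !restrict_EFin; apply: le_trans.
rewrite integral_mkcond le_eqVlt; apply/orP; left; apply/eqP; apply: eq_integral => x _.
rewrite restrict_EFin /= /F /G !patchE; case: ifPn => _.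
  by rewrite ger0_norm// mulr_ge0// normc_ge0.
by rewrite mulr0 normr0.
Qed.

Lemma Re_cinner_le f g : csqint f -> csqint g ->
  (`|complex.Re (cinner f g)|%:E <= cLnorm mu D 2%:E f * cLnorm mu D 2%:E g)%E.
Proof.
move=> sf sg; apply: le_trans (cauchy_schwarz (proj1 sf) (proj1 sg)).
have [i1 _] := csqint_mul sf sg.
rewrite /cinner /cintegral/= EFin_normr_Rintegral//.
apply: le_trans (le_abse_integral _ mD (proj1 (integrableP _ _ _ i1))) _.
have [mf _] := sf; have [mg _] := sg.
apply: ge0_le_integral => //.
- by apply: measurableT_comp => //; case/integrableP: i1.
- by apply/measurable_EFinP; apply: measurable_funM; exact: measurable_normc.
- move=> x Dx; rewrite /= lee_fin; apply: le_trans (ler_Re_normc _) _.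
  by rewrite normcM normc_conjc.
Qed.

End square_integrable.

Section Rintegral_sum.
Context {R : realType} {disp : measure_display} {X : measurableType disp}.
Variables (mu : {measure set X -> \bar R}) (D : set X).
Hypothesis mD : measurable D.

Lemma Rintegral_finite_sum (I : Type) (s : seq I) (F : I -> X -> R) :
  (forall i, mu.-integrable D (EFin \o F i)) ->
  \int[mu]_(x in D) (\sum_(i <- s) F i x) = \sum_(i <- s) \int[mu]_(x in D) F i x.
Proof.
move=> iF; elim: s => [|i s IH].
  by rewrite big_nil; under eq_Rintegral do rewrite big_nil; rewrite /Rintegral integral0.
rewrite big_cons -IH -RintegralD//.
  by apply: eq_Rintegral => x _; rewrite big_cons.
rewrite (_ : _ \o _ = (fun x => \sum_(j <- s) (EFin \o F j) x)%E); first exact: integrable_sum.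
by apply/funext => x; rewrite sumEFin.
Qed.

End Rintegral_sum.

Lemma cvge_lower_bound {R : realType} (u : nat -> \bar R) (l c : \bar R) :
  u @ \oo --> l -> (\forall n \near \oo, (c <= u n)%E) -> (c <= l)%E.
Proof.
move=> ul h; rewrite -(cvg_lim (@ereal_hausdorff R) ul).
by apply: lime_ge => //; apply/cvg_ex; exists l.
Qed.

(** * Continuity of the inner product *)

Section L2_limits.
Context {R : realType} {d : nat} (G : set 'rV[R]_d).
Hypothesis mG : measurable G.
Implicit Types f g : 'rV[R]_d -> R[i].

Let sq f := csqint lebesgue_rV G f.

Lemma csqint_L2 f : in_L2 G f -> csqint lebesgue_rV G f.
Proof. by move=> [mf foo]; exact: in_L2_csqint. Qed.

(** The real part of <f, f> is the integral of |f|^2, which is the square of the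
    norm; the square root is taken among extended reals. *)
Lemma L2norm_unit f : in_L2 G f -> inner G f f = 1 -> L2norm G f = 1%E.
Proof.
move=> fL2 ff; have [mf ifi] := csqint_L2 fL2.
have sqE : (\int[lebesgue_rV]_(x in G) (normc (f x) ^+ 2)%:E = 1)%E.
  have := congr1 (@complex.Re R) ff; rewrite /inner /cintegral/= /Rintegral => h.
  rewrite -(fineK (integrable_fin_num mG ifi)); congr EFin.
  rewrite -[RHS]h; congr fine; apply: eq_integral => x _; congr EFin.
  by rewrite Re_mulc; case: (f x) => a b /=; rewrite sqr_sqrtr ?addr_ge0 ?sqr_ge0//; ring.
rewrite /L2norm; have := cLnorm2_sqr lebesgue_rV G f; rewrite sqE => e.
have -> : cLnorm lebesgue_rV G 2%:E f = ((cLnorm lebesgue_rV G 2%:E f `^ 2) `^ 2^-1)%E.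
  by rewrite -poweRrM divff// poweRe1// Lnorm_ge0.
by rewrite e poweR_EFin powR1.
Qed.

(** Cauchy-Schwarz against a unit vector: f |-> Re <f, e> is 1-Lipschitz. *)
Lemma Re_inner_dist f g e : in_L2 G f -> in_L2 G g -> in_L2 G e -> L2norm G e = 1%E ->
  (`|complex.Re (inner G f e) - complex.Re (inner G g e)|%:E <= L2norm G (fun x => (f x - g x)%R))%E.
Proof.
move=> /csqint_L2 sf /csqint_L2 sg /csqint_L2 se e1.
have sN : sq (fun x => - g x).
  by have := csqintZ mG (-1) sg; rewrite /sq; under eq_fun do rewrite mulN1r.
have sD : sq (fun x => f x - g x) by exact: csqintD.
have := Re_cinner_le mG sD se.
rewrite -[X in (_ * X)%E]/(L2norm G e) e1 mule1.
have -> : cinner lebesgue_rV G (fun x => f x - g x) e = inner G f e - inner G g e.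
  rewrite cinnerD//; congr (_ + _).
  rewrite -[LHS]/(cinner _ _ (fun x => - g x) e).
  have -> : (fun x => - g x) = (fun x => -1 * g x) by apply/funext => x; rewrite mulN1r.
  by rewrite cinnerZ// mulN1r.
by case: (inner G f e) => a b; case: (inner G g e).
Qed.

Lemma in_L2Z (c : R[i]) f : in_L2 G f -> csqint lebesgue_rV G (fun x => c * f x).
Proof. by move=> fL2; exact: (csqintZ mG c (csqint_L2 fL2)). Qed.

Lemma csqint_in_L2 f : csqint lebesgue_rV G f -> in_L2 G f.
Proof.
move=> [mf fi]; split => //; rewrite /L2norm.
have := cLnorm2_sqr lebesgue_rV G f => e.
have -> : cLnorm lebesgue_rV G 2%:E f = ((cLnorm lebesgue_rV G 2%:E f `^ 2) `^ 2^-1)%E.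
  by rewrite -poweRrM divff// poweRe1// Lnorm_ge0.
by apply: poweR_lty; rewrite e ltey_eq (integrable_fin_num mG fi).
Qed.

(** The inner product of e n with the partial sum of order N is c n as soon as
    N > n; it passes to the limit by Re_inner_dist. *)
Lemma Re_inner_L2cvg (e : nat -> 'rV[R]_d -> R[i]) (c : nat -> R[i]) Y n :
  hilbert_basis G e -> in_L2 G Y ->
  L2cvg G (fun N x => \sum_(m < N) c m * e m x) Y ->
  complex.Re (inner G Y (e n)) = complex.Re (c n).
Proof.
move=> [eL2 eo _] YL2 h.
have en1 : L2norm G (e n) = 1%E by apply: L2norm_unit => //; rewrite eo eqxx.
pose S N x := \sum_(m < N) c m * e m x.
have sc m : csqint lebesgue_rV G (fun x => c m * e m x) by exact: in_L2Z.
have sS N : csqint lebesgue_rV G (S N).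
  exact: (csqint_sum mG (index_enum 'I_N) (F := fun m x => c m * e m x)).
have inS N : (n < N)%N -> inner G (S N) (e n) = c n.
  move=> nN; have := @cinner_sum _ _ _ lebesgue_rV G mG _ (index_enum 'I_N)
    (fun m x => c m * e m x) (e n) (fun m => sc m) (csqint_L2 (eL2 n)).
  rewrite -[LHS]/(inner G (S N) (e n)) => ->.
  have cE m : cinner lebesgue_rV G (fun x => c m * e m x) (e n) = c m * (m == n)%:R.
    by rewrite (cinnerZ mG (c m) (csqint_L2 (eL2 m)) (csqint_L2 (eL2 n))) -(eo m n).
  rewrite (bigD1 (Ordinal nN))//= cE eqxx mulr1 big1 ?addr0// => i /eqP iN.
  rewrite cE; have -> : (i == n :> nat) = false by apply/negbTE/eqP => E; apply: iN; exact: val_inj.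
  by rewrite mulr0.
apply/eqP; rewrite eq_sym -subr_eq0 -normr_le0 -lee_fin.
have h' : (fun N => L2norm G (fun x => S N x - Y x)) @ \oo --> 0%E by exact: h.
apply: (cvge_lower_bound h'); near=> N.
rewrite -(inS N); last by near: N; exact: nbhs_infty_gt.
exact: (Re_inner_dist (csqint_in_L2 (sS N)) YL2 (eL2 n) en1).
Unshelve. all: by end_near.
Qed.

Context {disp : measure_display} {Omega : measurableType disp}.
Variable P : probability Omega R.

(** For simple functions the identity is linearity. The general case follows
    because Re <_, e> is 1-Lipschitz: the error is at most the mean distance to
    the approximating simple functions plus the distance between the means. *)
Lemma Re_inner_expectation (Y : Omega -> 'rV[R]_d -> R[i]) m e (r : Omega -> R) :
  (forall w, in_L2 G (Y w)) -> in_L2 G m -> in_L2 G e -> L2norm G e = 1%E ->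
  (forall w, r w = complex.Re (inner G (Y w) e)) ->
  P.-integrable setT (EFin \o r) ->
  is_expectation G P Y m -> complex.Re (inner G m e) = \int[P]_w r w.
Proof.
move=> YL2 mL2 eL2 e1 rE ri [S /= [mdist cdist cexp]].
have se := csqint_L2 eL2.
pose a k j := complex.Re (inner G (@simple_coef _ _ _ _ _ (S k) j) e).
pose q k w := \sum_(j < simple_size (S k)) (\1_(@simple_set _ _ _ _ _ (S k) j) w) * a k j.
have sc k j : csqint lebesgue_rV G (@simple_coef _ _ _ _ _ (S k) j).
  by apply: csqint_L2; exact: simple_coefP.
have scZ k (z : 'I_(simple_size (S k)) -> R[i]) j :
    csqint lebesgue_rV G (fun x => z j * @simple_coef _ _ _ _ _ (S k) j x).
  exact: (csqintZ mG (z j) (sc k j)).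
have sumL2 k (z : 'I_(simple_size (S k)) -> R[i]) :
    csqint lebesgue_rV G (fun x => \sum_j z j * @simple_coef _ _ _ _ _ (S k) j x).
  exact: (csqint_sum mG _ (scZ k z)).
have sumE k (z : 'I_(simple_size (S k)) -> R[i]) :
    inner G (fun x => \sum_j z j * @simple_coef _ _ _ _ _ (S k) j x) e =
    \sum_j z j * inner G (@simple_coef _ _ _ _ _ (S k) j) e.
  have E : inner G (fun x => \sum_j z j * @simple_coef _ _ _ _ _ (S k) j x) e =
      \sum_j cinner lebesgue_rV G (fun x => z j * @simple_coef _ _ _ _ _ (S k) j x) e.
    exact: (cinner_sum mG _ (scZ k z) se).
  by rewrite E; apply: eq_bigr => j _; exact: (cinnerZ mG (z j) (sc k j) se).
have sv k w : csqint lebesgue_rV G (simple_val (S k) w) by exact: sumL2.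
have sx k : csqint lebesgue_rV G (simple_expectation P (S k)) by exact: sumL2.
have ReZ (c : R) (z : R[i]) : complex.Re (c%:C * z) = c * complex.Re z.
  by rewrite Re_mulc/= mul0r subr0.
have Resum (I : Type) (s : seq I) (F : I -> R[i]) :
    complex.Re (\sum_(i <- s) F i) = \sum_(i <- s) complex.Re (F i).
  elim: s => [|i s IH]; first by rewrite !big_nil.
  by rewrite !big_cons -IH; case: (F i) => ? ?; case: (\sum_(_ <- _) _).
have qE k w : q k w = complex.Re (inner G (simple_val (S k) w) e).
  by rewrite /simple_val sumE Resum; apply: eq_bigr => j _; rewrite ReZ.
have mA k j : measurable (@simple_set _ _ _ _ _ (S k) j) by exact: simple_setP.
have i1 k j : P.-integrable setT (EFin \o (\1_(@simple_set _ _ _ _ _ (S k) j) : Omega -> R)).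
  by apply: integrable_indic => //; exact: ltry.
have qi k j : P.-integrable setT (EFin \o (fun w => a k j * \1_(@simple_set _ _ _ _ _ (S k) j) w)).
  rewrite (_ : _ \o _ = (fun w => (a k j)%:E * (EFin \o (\1_(@simple_set _ _ _ _ _ (S k) j) : Omega -> R)) w)%E)//.
  exact: integrableZl.
have iq k : P.-integrable setT (EFin \o q k).
  rewrite (_ : _ \o _ = (fun w => \sum_(j < simple_size (S k))
      (EFin \o (fun w => (a k j * \1_(@simple_set _ _ _ _ _ (S k) j) w)%R)) w)%E).
    exact: integrable_sum.
  by apply/funext => w; rewrite sumEFin; congr EFin; apply: eq_bigr => j _; rewrite mulrC.
have Eq k : \int[P]_w q k w = complex.Re (inner G (simple_expectation P (S k)) e).
  rewrite /simple_expectation sumE Resum /q.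
  under eq_Rintegral do under eq_bigr do rewrite mulrC.
  rewrite Rintegral_finite_sum//; apply: eq_bigr => j _.
  by rewrite RintegralZl// ReZ mulrC /Rintegral integral_indic// setIT.
apply/eqP; rewrite eq_sym -subr_eq0 -normr_le0 -lee_fin.
have lim0 : (\int[P]_w L2norm G (fun x => (Y w x - simple_val (S k) w x)%R) +
   L2norm G (fun x => (simple_expectation P (S k) x - m x)%R))%E @[k --> \oo] --> 0%E.
  by rewrite -[X in _ --> X]adde0; apply: cvgeD.
apply: (cvge_lower_bound lim0); near=> k.
have h2 : (`|complex.Re (inner G (simple_expectation P (S k)) e) - complex.Re (inner G m e)|%:E <=
  L2norm G (fun x => (simple_expectation P (S k) x - m x)%R))%E.
  exact: (Re_inner_dist (csqint_in_L2 (sx k)) mL2 eL2 e1).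
have h1 : (`|\int[P]_w r w - \int[P]_w q k w|%:E <=
  \int[P]_w L2norm G (fun x => (Y w x - simple_val (S k) w x)%R))%E.
  have irq : P.-integrable setT (EFin \o (fun w => r w - q k w)).
    rewrite (_ : _ \o _ = (EFin \o r) \- (EFin \o q k))%E//; exact: integrableB.
  rewrite -RintegralB// EFin_normr_Rintegral//.
  apply: le_trans (le_abse_integral _ measurableT (proj1 (integrableP _ _ _ irq))) _.
  apply: ge0_le_integral => //.
  - by apply: measurableT_comp => //; case/integrableP: irq.
  - move=> w _; rewrite /= rE qE; exact: (Re_inner_dist (YL2 w) (csqint_in_L2 (sv k w)) eL2 e1).
apply: le_trans (leeD h1 h2); rewrite -EFinD lee_fin Eq.
have -> : \int[P]_w r w - complex.Re (inner G m e) = (\int[P]_w r w - complex.Re (inner G (simple_expectation P (S k)) e)) +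
  (complex.Re (inner G (simple_expectation P (S k)) e) - complex.Re (inner G m e)) by ring.
exact: ler_normD.
Unshelve. all: by end_near.
Qed.

End L2_limits.

Lemma measurable_Rintegral_section {R : realType} {d1 d2 : measure_display}
  (T1 : measurableType d1) (T2 : measurableType d2)
  (m2 : {sigma_finite_measure set T2 -> \bar R}) (f : T1 * T2 -> R) :
  measurable_fun setT f -> measurable_fun setT (fun s => \int[m2]_x f (s, x)).
Proof.
move=> mf; have mf' : measurable_fun setT (EFin \o f) by exact/measurable_EFinP.
apply: (@measurableT_comp _ _ _ _ _ _ (@fine R)); first exact: fine_measurable.
have mp := measurable_fun_fubini_tonelli_F (m2 := m2) (EFin \o f)^\+%E
  (measurable_funepos mf') (fun z => funepos_ge0 _ z).
have mn := measurable_fun_fubini_tonelli_F (m2 := m2) (EFin \o f)^\-%E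
  (measurable_funeneg mf') (fun z => funeneg_ge0 _ z).
apply: eq_measurable_fun (emeasurable_funB mp mn) => s _.
by rewrite [RHS]integralE; congr (_ - _)%E; apply: eq_integral => x _; rewrite ?funeposE ?funenegE.
Qed.

(** The product measure is the integral of the measures of the sections. *)
Lemma ae_xsection0 {R : realType} {d1 d2 : measure_display}
  (T1 : measurableType d1) (T2 : measurableType d2)
  (m1 : {sigma_finite_measure set T1 -> \bar R})
  (m2 : {sigma_finite_measure set T2 -> \bar R}) (N : set (T1 * T2)) :
  measurable N -> (m1 \x m2)%E N = 0%E -> {ae m1, forall s, m2 (xsection N s) = 0%E}.
Proof.
move=> mN N0.
have mphi := measurable_fun_xsection m2 mN.
have : (\int[m1]_s `|(m2 \o xsection N) s| = 0)%E.
  by rewrite -[RHS]N0; apply: eq_integral => s _; rewrite gee0_abs.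
move/(ae_eq_integral_abs m1 measurableT mphi).
by apply: filterS => s /= /(_ I).
Qed.

Lemma normr_Rintegral_le {R : realType} {d : measure_display} {T : measurableType d}
  (mu : {measure set T -> \bar R}) (D : set T) (f g : T -> R) : measurable D ->
  mu.-integrable D (EFin \o f) -> mu.-integrable D (EFin \o g) ->
  (forall x, D x -> `|f x| <= g x) -> `|\int[mu]_(x in D) f x| <= \int[mu]_(x in D) g x.
Proof.
move=> mD fi gi fg; apply: le_trans (le_normr_Rintegral mD fi) _.
apply: le_Rintegral => //.
by rewrite (_ : _ \o _ = abse \o (EFin \o f))//; exact: integrable_abse.
Qed.

(** * Cutting off an essentially bounded control *)

Section cutoff.
Context {R : realType} {disp : measure_display} {X : measurableType disp}.
Variable m2 : {sigma_finite_measure set X -> \bar R}.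
Variables (I : set R) (G G0 : set X) (u : R * X -> R[i]) (e : X -> R[i]) (C : R).
Hypotheses (mI : measurable I) (mG : measurable G) (mG0 : measurable G0).
Hypothesis G0G : G0 `<=` G.
Hypothesis C0 : 0 <= C.
Hypothesis mes_u : cmeasurable_fun (I `*` G0) u.
Hypothesis mes_e : cmeasurable_fun G e.
Hypothesis ie : m2.-integrable G (EFin \o (fun x => normc (e x))).
Hypothesis uC : (cLnorm (lebesgue_measure \x m2)%E (I `*` G0) +oo%E u <= C%:E)%E.

Local Notation m1 := (@lebesgue_measure R).
Let D : set (R * X) := I `*` G0.
Let mD : measurable D. Proof. exact: measurableX. Qed.

Let K := C * \int[m2]_(x in G) normc (e x).

(* the product u(s,x) conj(e x), extended by 0 *)
Let w (z : R * X) : R[i] := (\1_D z)%:C * (u z * conjc (e z.2)).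
Let N : set (R * X) := D `&` [set z | C < normc (u z)].
Let v (z : R * X) : R[i] := (\1_(~` N) z)%:C * w z.

Let mN : measurable N.
Proof.
have mn := measurable_normc mes_u.
rewrite /N; have := mn mD _ (measurable_itv `]C, +oo[).
by congr measurable; apply/seteqP; split => z /= [Dz]; rewrite in_itv/= andbT.
Qed.

Let N0 : (m1 \x m2)%E N = 0%E.
Proof.
pose F := (fun z : R * X => (normc (u z))%:E) \_ D.
have mF : measurable_fun setT F.
  by apply/(measurable_restrictT _ mD)/measurable_EFinP; exact: measurable_normc.
(* the norm at +oo is defined by cases on the total mass *)
have [T0|T0] := ltP 0%E ((m1 \x m2)%E [set: R * X]); last first.
  apply/eqP; rewrite eq_le measure_ge0 andbT; apply: le_trans T0.
  by apply: le_measure; rewrite ?inE.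
move: uC; rewrite /cLnorm unlock T0 -/F => /ess_supP h.
have hF : (\forall z \ae (m1 \x m2)%E, (F z <= C%:E)%E).
  by apply: filterS h => z; apply: le_trans; exact: lee_abs.
have h0 := proj1 (ae_le_measureP (m1 \x m2)%E C%:E mF) hF.
apply/eqP; rewrite eq_le measure_ge0 andbT -h0; apply: le_measure; rewrite ?inE//.
- by rewrite -[X in measurable X]setTI; apply: mF => //; exact: emeasurable_itv.
- by move=> z [Dz Cz]; rewrite /= in_itv/= andbT /F patchE mem_set// lte_fin.
Qed.

Let mw : cmeasurable_fun setT w.
Proof.
have me2 : cmeasurable_fun D (fun z => conjc (e z.2)).
  apply: cmeasurable_conjc.
  have [e1 e2] := mes_e.
  have sD : snd @` D `<=` G by move=> _ [[s x] [_ /G0G ? ]] <-.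
  have mD' : measurable_fun D (snd : R * X -> X) by apply: measurable_funTS; exact: measurable_snd.
  split; [exact: (measurable_comp mG sD e1 mD')|exact: (measurable_comp mG sD e2 mD')].
have [p1 p2] := cmeasurable_funM mes_u me2.
have indE (c : R[i]) (z : R * X) : complex.Re ((\1_D z)%:C * c) = \1_D z * complex.Re c /\
  complex.Im ((\1_D z)%:C * c) = \1_D z * complex.Im c.
  by rewrite Re_mulc Im_mulc/= !mul0r subr0 addr0.
split.
- move/(measurable_restrictT _ mD): p1; apply: eq_measurable_fun => z _.
  by rewrite /w (indE _ _).1 patchE indicE; case: ifPn; rewrite ?mul1r ?mul0r.
- move/(measurable_restrictT _ mD): p2; apply: eq_measurable_fun => z _.
  by rewrite /w (indE _ _).2 patchE indicE; case: ifPn; rewrite ?mul1r ?mul0r.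
Qed.

Let mv : cmeasurable_fun setT v.
Proof.
apply: cmeasurable_funM => //; split; last exact: measurable_cst.
have : measurable_fun setT (\1_(~` N) : R * X -> R) by apply: measurable_indic; exact: measurableC.
exact.
Qed.

Let W s := cintegral m2 setT (fun x => w (s, x)).
Let V s := cintegral m2 setT (fun x => v (s, x)).

(** The indicator of I x G0 in w accounts for the localization to G0, and w
    vanishes off G because G0 lies in G. *)
Let WE s : I s -> cinner m2 G (fun x => (\1_G0 x)%:C * u (s, x)) e = W s.
Proof.
move=> Is; rewrite /cinner /W /cintegral [X in X +i* _]Rintegral_mkcond [X in _ +i* X]Rintegral_mkcond.
have h x : (\1_G0 x)%:C * u (s, x) * conjc (e x) = w (s, x).
  rewrite /w !indicE /D -mulrA; congr (_%:R%:C * _).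
  by congr nat_of_bool; apply/idP/idP; rewrite !inE; [move=> G0x; split|case].
have z x : x \notin G -> w (s, x) = 0.
  move=> /negP xG; rewrite /w indicE memNset ?mul0r// => -[_ /G0G /= Gx].
  by apply: xG; rewrite inE.
congr (_ +i* _); apply: eq_Rintegral => x _; rewrite patchE; case: ifPn => [_|/z ->//]; by rewrite h.
Qed.

Let v_le s x : normc (v (s, x)) <= C * (\1_G x * normc (e x)).
Proof.
rewrite /v /w !normcM !normc_real !ger0_norm// normc_conjc.
rewrite !indicE.
have [Nz|Nz] := boolP ((s, x) \in ~` N); last by rewrite mul0r mulr_ge0// mulr_ge0// normc_ge0.
have [Dz|Dz] := boolP ((s, x) \in D); last by rewrite mul0r mulr0 mulr_ge0// mulr_ge0// normc_ge0.
rewrite !mul1r; move: Dz; rewrite inE => Dz; have [_ /G0G Gx] := Dz.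
rewrite mem_set// mul1r ler_wpM2r ?normc_ge0// leNgt; apply/negP => h.
by move: Nz; rewrite inE; apply.
Qed.

Let ie1 : m2.-integrable setT (EFin \o (fun x => C * (\1_G x * normc (e x)))).
Proof.
rewrite (_ : _ \o _ = (fun x => C%:E * ((fun x => (normc (e x))%:E) \_ G) x)%E).
  by apply: integrableZl => //; apply/integrable_restrict => //; rewrite setTI.
apply/funext => x; rewrite /= patchE indicE; case: ifPn => _; rewrite ?mul1r ?mul0r ?mulr0 ?mule0//.
Qed.

Let iv s : cintegrable m2 setT (fun x => v (s, x)).
Proof.
apply: (le_cintegrable measurableT _ ie1) => [|x _]; last exact: v_le.
have [v1 v2] := mv.
by split; [exact: (measurable_fun_pair2 s v1)|exact: (measurable_fun_pair2 s v2)].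
Qed.

Let KE : \int[m2]_x (C * (\1_G x * normc (e x))) = K.
Proof.
have iG : m2.-integrable setT (EFin \o ((fun x => normc (e x)) \_ G)).
  by rewrite -restrict_EFin; apply/integrable_restrict => //; rewrite setTI; exact: ie.
rewrite /K [in RHS]Rintegral_mkcond -(RintegralZl C measurableT iG).
apply: eq_Rintegral => x _; rewrite patchE indicE; case: ifPn => _; rewrite ?mul1r ?mul0r//.
Qed.

Let V_le s : `|complex.Re (V s)| <= K /\ `|complex.Im (V s)| <= K.
Proof.
have [i1 i2] := iv s; rewrite -KE.
split; apply: (normr_Rintegral_le measurableT _ ie1) => // x _.
- exact: le_trans (ler_Re_normc _) (v_le _ _).
- exact: le_trans (ler_Im_normc _) (v_le _ _).
Qed.

(** W is the inner product of the control with e, and V the same inner product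
    after u has been replaced by 0 where its modulus exceeds C. Both depend
    measurably on s, V is bounded at every s, and they agree at almost every s
    because the exceptional null set has null sections. *)
Lemma cutoff_section : exists W V : R -> R[i],
  [/\ cmeasurable_fun setT W, cmeasurable_fun setT V,
     forall s, I s -> cinner m2 G (fun x => (\1_G0 x)%:C * u (s, x)) e = W s,
     {ae lebesgue_measure, forall s, W s = V s} &
     forall s, `|complex.Re (V s)| <= C * \int[m2]_(x in G) normc (e x) /\
               `|complex.Im (V s)| <= C * \int[m2]_(x in G) normc (e x)].
Proof.
exists W, V; split => //.
- by have [w1 w2] := mw; split; [exact: (measurable_Rintegral_section m2 w1)|exact: (measurable_Rintegral_section m2 w2)].
- by have [v1 v2] := mv; split; [exact: (measurable_Rintegral_section m2 v1)|exact: (measurable_Rintegral_section m2 v2)].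
- have := @ae_xsection0 R _ _ _ X m1 m2 N mN N0; apply: filterS => s sN.
  have [w1 w2] := mw; have [v1 v2] := mv.
  have aeN : {ae m2, forall x, w (s, x) = v (s, x)}.
    exists (xsection N s); split => //; first exact: measurable_xsection.
    move=> x /= h; apply/mem_set; have [//|Nx] := pselect (N (s, x)); exfalso; apply: h.
    by rewrite /v indicE mem_set// mul1r.
  rewrite /W /V /cintegral /Rintegral; congr (fine _ +i* fine _); apply: ae_eq_integral => //.
  + by apply/measurable_EFinP; exact: (measurable_fun_pair2 s w1).
  + by apply/measurable_EFinP; exact: (measurable_fun_pair2 s v1).
  + by apply: filterS aeN => x -> _.
  + by apply/measurable_EFinP; exact: (measurable_fun_pair2 s w2).
  + by apply/measurable_EFinP; exact: (measurable_fun_pair2 s v2).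
  + by apply: filterS aeN => x -> _.
Qed.

End cutoff.

(** * The singular kernel in time *)

Section kernel.
Context {R : realType}.
Variables (alpha T : R).
Hypotheses (ha : 0 < alpha < 1) (T0 : 0 < T).
Notation mu := (@lebesgue_measure R).

Let a0 : 0 < alpha. Proof. by case/andP: ha. Qed.

Let F s := - (T - s) `^ alpha / alpha.

Let dF s : s < T -> is_derive s 1 F ((T - s) `^ (alpha - 1)).
Proof.
move=> sT; have Ts : 0 < T - s by rewrite subr_gt0.
have h1 : is_derive (T - s) 1 (fun t => t `^ alpha) (alpha * (T - s) `^ (alpha - 1)).
  exact: is_derive1_powR.
have h2 : is_derive s 1 (fun s => T - s) (-1).
  by have := is_deriveB (is_derive_cst T s 1) (is_derive_id s 1); rewrite sub0r.
have h3 := @is_derive1_comp R (fun t => t `^ alpha) (fun s => T - s) s _ _ h1 h2.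
have h4 : is_derive s 1 (fun t => - alpha^-1 * (T - t) `^ alpha)
    (- alpha^-1 * (alpha * (T - s) `^ (alpha - 1) * -1)) by exact: is_deriveZ h3.
have -> : F = (fun t => - alpha^-1 * (T - t) `^ alpha).
  by apply/funext => t; rewrite /F; ring.
by apply: is_derive_eq; field; rewrite gt_eqF.
Qed.

Let cF s : s < T -> {for s, continuous F}.
Proof.
by move=> sT; apply/differentiable_continuous/derivable1_diffP; have [] := dF sT.
Qed.

Lemma measurable_powR_kernel : measurable_fun setT (fun s : R => (T - s) `^ (alpha - 1)).
Proof.
apply: (@measurableT_comp _ _ _ _ _ _ (fun t => t `^ (alpha - 1))).
  exact: measurable_powR.
exact: measurable_funB.
Qed.

Let ck s : s < T -> {for s, continuous (fun s => (T - s) `^ (alpha - 1))}.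
Proof.
move=> sT; have Ts : 0 < T - s by rewrite subr_gt0.
apply: (@continuous_comp _ _ _ (fun s => T - s) (fun t => t `^ (alpha - 1))).
  by apply: cvgB; [exact: cvg_cst|exact: cvg_id].
apply/differentiable_continuous/derivable1_diffP.
by have [] := is_derive1_powR (alpha - 1) Ts.
Qed.

(** The primitive - (T - s)^alpha / alpha is bounded since alpha > 0, and the
    singularity at T is reached by monotone convergence over [0, T - T / (n+2)]. *)
Lemma integrable_powR_kernel :
  mu.-integrable `]0, T[ (EFin \o (fun s => (T - s) `^ (alpha - 1))).
Proof.
apply/integrableP; split.
  by apply: measurable_funTS; apply/measurable_EFinP; exact: measurable_powR_kernel.
under eq_integral do rewrite gee0_abs ?lee_fin ?powR_ge0//.
pose b (n : nat) := T - T / n.+2%:R.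
have bT n : b n < T by rewrite /b ltrBlDr ltrDl divr_gt0.
have b0 n : 0 < b n by rewrite /b subr_gt0 ltr_pdivrMr// ltr_pMr// ltr1n.
have cov : `]0%R, T[%classic `<=` \bigcup_n [set` `[0, b n]].
  move=> s /=; rewrite in_itv/= => /andP[s0 sT].
  pose m : nat := Num.truncn (T / (T - s)).
  have Ts : 0 < T - s by rewrite subr_gt0.
  exists m => //=; rewrite in_itv/= (ltW s0)/= /b lerBrDl addrC -lerBrDl.
  rewrite ler_pdivrMr// mulrC -ler_pdivrMr// ltW//.
  by apply: lt_le_trans (truncnS_gt _) _; rewrite ler_nat.
have kge0 s : (0 <= ((T - s) `^ (alpha - 1))%:E)%E by rewrite lee_fin powR_ge0.
have mk (A : set R) : measurable_fun A (fun s => ((T - s) `^ (alpha - 1))%:E).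
  by apply: measurable_funTS; apply/measurable_EFinP; exact: measurable_powR_kernel.
apply: (@le_lt_trans _ _ (\int[mu]_(s in \bigcup_n [set` `[0%R, b n]]) ((T - s) `^ (alpha - 1))%:E)%E).
  apply: ge0_subset_integral => //.
  - by apply: bigcup_measurable => n _; exact: measurable_itv.
  - exact: mk.
  - by move=> s _; exact: kge0.
apply: (@le_lt_trans _ _ (T `^ alpha / alpha)%:E); last exact: ltry.
have nd : nondecreasing_seq (fun n => [set` `[0%R, b n]] : set R).
  move=> m n mn; apply/subsetPset => s /=; rewrite !in_itv/= => /andP[-> sb]/=.
  apply: le_trans sb _; rewrite /b lerD2l lerN2 ler_pM2l// lef_pV2 ?posrE//.
  by rewrite ler_nat !ltnS.
have h := @ge0_nondecreasing_set_cvg_integral _ (measurableTypeR R) R (fun n => [set` `[0%R, b n]])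
  (fun s => ((T - s) `^ (alpha - 1))%:E) mu nd (fun n => measurable_itv _) (fun n => mk _)
  (fun n s _ => kge0 s).
rewrite -(cvg_lim (@ereal_hausdorff R) h).
apply: lime_le; first by apply/cvg_ex; eexists; exact: h.
apply: nearW => n.
have -> : (\int[mu]_(s in `[0%R, b n]) ((T - s) `^ (alpha - 1))%:E = (F (b n))%:E - (F 0)%:E)%E.
  apply: continuous_FTC2 => //.
  - apply: continuous_in_subspaceT => s; rewrite inE/= in_itv/= => /andP[_ sb].
    by apply: ck; exact: le_lt_trans (bT n).
  - split.
    + move=> s; rewrite in_itv/= => /andP[_ sb].
      by have [] := dF (lt_trans sb (bT n)).
    + by apply: cvg_at_right_filter; exact: cF.
    + by apply: cvg_at_left_filter; exact: cF.
  - move=> s; rewrite in_itv/= => /andP[_ sb]; rewrite derive1E.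
    by have [_ ->] := dF (lt_trans sb (bT n)).
rewrite -EFinB lee_fin /F subr0 !mulNr opprK addrC.
by rewrite gerDl oppr_le0 divr_ge0 ?powR_ge0// ltW.
Qed.

End kernel.

Lemma normc_le_ReIm {R : realType} (z : R[i]) :
  normc z <= `|complex.Re z| + `|complex.Im z|.
Proof.
have e : z = (complex.Re z)%:C + (0 +i* complex.Im z).
  by case: z => a b; apply/eqP; rewrite eq_complex/= addr0 add0r !eqxx.
rewrite {1}e; apply: le_trans (le_normcD _ _) _.
by rewrite normc_real normc_imag.
Qed.

Lemma bounded_cintegrable {R : realType} {disp : measure_display}
  {Omega : measurableType disp} (P : probability Omega R) (f : Omega -> R[i]) (B : R) :
  cmeasurable_fun setT f -> (forall w, normc (f w) <= B) -> cintegrable P setT f.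
Proof.
move=> mf fB; have iB : P.-integrable setT (EFin \o (fun=> B)) by exact: finite_measure_integrable_cst.
by apply: (le_cintegrable measurableT mf iB) => w _; exact: fB.
Qed.

Lemma normc_expectation_le {R : realType} {disp : measure_display}
  {Omega : measurableType disp} (P : probability Omega R) (f : Omega -> R[i]) (B : R) :
  cmeasurable_fun setT f -> (forall w, normc (f w) <= B) ->
  normc (cintegral P setT f) <= 2 * B.
Proof.
move=> mf fB; have [c1 c2] := bounded_cintegrable P mf fB.
have iB : P.-integrable setT (EFin \o (fun=> B)) by exact: finite_measure_integrable_cst.
have iBE : \int[P]_w B = B.
  by have := Rintegral_cst P (@measurableT _ Omega) B; rewrite /= probability_setT mulr1.
have h1 : `|complex.Re (cintegral P setT f)| <= B.
  rewrite -[leRHS]iBE; apply: (normr_Rintegral_le measurableT c1 iB) => w _.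
  exact: le_trans (ler_Re_normc _) (fB w).
have h2 : `|complex.Im (cintegral P setT f)| <= B.
  rewrite -[leRHS]iBE; apply: (normr_Rintegral_le measurableT c2 iB) => w _.
  exact: le_trans (ler_Im_normc _) (fB w).
by apply: le_trans (normc_le_ReIm _) _; lra.
Qed.

(** * Averaging over the random parameter *)

Section averaging.
Context {R : realType} {disp : measure_display} {Omega : measurableType disp}.
Variable P : probability Omega R.
Notation m1 := (@lebesgue_measure R).
Variables (I : set R) (k : R -> R) (W V : R -> R[i]) (E : Omega -> R -> R[i]) (K B : R).
Hypotheses (mI : measurable I) (mk : measurable_fun setT k) (k0 : forall s, 0 <= k s).
Hypothesis ik : m1.-integrable I (EFin \o k).
Hypotheses (mW : cmeasurable_fun setT W) (mV : cmeasurable_fun setT V).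
Hypothesis WV : {ae m1, forall s, W s = V s}.
Hypothesis VK : forall s, `|complex.Re (V s)| <= K /\ `|complex.Im (V s)| <= K.
Hypothesis mE : cmeasurable_fun setT (fun z : Omega * R => E z.1 z.2).
Hypothesis EB : forall w s, normc (E w s) <= B.

Let K0 : 0 <= K. Proof. exact: le_trans (normr_ge0 _) (VK 0).1. Qed.
Let B0 : 0 <= B. Proof. exact: le_trans (normc_ge0 _) (EB point 0). Qed.

Let F (z : Omega * R) : R :=
  \1_I z.2 * k z.2 * (complex.Re (V z.2) * complex.Re (E z.1 z.2) -
                     complex.Im (V z.2) * complex.Im (E z.1 z.2)).

Let ind_measurable : measurable_fun setT (fun s : R => \1_I s * k s).
Proof. by apply: measurable_funM => //; exact: measurable_indic. Qed.

Let ik1 : m1.-integrable setT (EFin \o (fun s => \1_I s * k s)).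
Proof.
rewrite (_ : _ \o _ = (EFin \o k) \_ I); first by apply/integrable_restrict => //; rewrite setTI.
by apply/funext => s; rewrite /= patchE indicE; case: ifPn => _; rewrite ?mul1r ?mul0r.
Qed.

Let igc (c : R) : m1.-integrable setT (EFin \o (fun s => c * (\1_I s * k s))).
Proof.
rewrite (_ : _ \o _ = (fun s => c%:E * (EFin \o (fun s => \1_I s * k s)%R) s)%E)//.
exact: integrableZl.
Qed.

Let mF : measurable_fun setT F.
Proof.
have snd' (g : R -> R) : measurable_fun setT g -> measurable_fun setT (fun z : Omega * R => g z.2).
  by move=> mg; apply: (measurableT_comp mg); exact: measurable_snd.
have [V1 V2] := mV; have [E1 E2] := mE.
apply: measurable_funM; first exact: (snd' _ ind_measurable).
by apply: measurable_funB; apply: measurable_funM => //; [exact: (snd' _ V1)|exact: (snd' _ V2)].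
Qed.

Let prod_le (a b c e : R) : `|a| <= K -> `|b| <= K -> `|c| <= B -> `|e| <= B ->
  `|a * c - b * e| <= 2 * K * B.
Proof.
move=> ha hb hc he; apply: le_trans (ler_normB _ _) _; rewrite !normrM.
by rewrite -mulrA mulr_natl mulr2n lerD// ler_pM.
Qed.

Let ind0 s : 0 <= \1_I s * k s.
Proof. by rewrite mulr_ge0. Qed.

(** A bound uniform in w: this is what makes F integrable on the product and
    Fubini's theorem applicable. *)
Let F_le w s : `|F (w, s)| <= 2 * K * B * (\1_I s * k s).
Proof.
rewrite /F normrM (ger0_norm (ind0 s)) mulrC ler_wpM2r ?ind0//=.
have [h1 h2] := VK s.
apply: prod_le => //; [exact: le_trans (ler_Re_normc _) (EB w s)|exact: le_trans (ler_Im_normc _) (EB w s)].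
Qed.

Let mFw w : measurable_fun setT (fun s => F (w, s)).
Proof. exact: (measurable_fun_pair2 w mF). Qed.

Let iFw w : m1.-integrable setT (EFin \o (fun s => F (w, s))).
Proof.
apply: (le_integrable measurableT _ _ (igc (2 * K * B))).
  by apply/measurable_EFinP; exact: mFw.
by move=> s _ /=; rewrite lee_fin; apply: le_trans (F_le w s) (ler_norm _).
Qed.

Let iF : (P \x m1)%E.-integrable setT (EFin \o F).
Proof.
apply/integrable12ltyP; first exact/measurable_EFinP.
pose c := (\int[m1]_s (2 * K * B * (\1_I s * k s))%:E)%E.
have cfin : c \is a fin_num by exact: (integrable_fin_num measurableT (igc _)).
apply: (@le_lt_trans _ _ (\int[P]_w c)%E).
  apply: ge0_le_integral => //.
  - by move=> w _; exact: integral_ge0.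
  - apply: (measurable_fun_fubini_tonelli_F (m2 := m1) (abse \o (EFin \o F))) => [|z]; last exact: abse_ge0.
    by apply: measurableT_comp => //; exact/measurable_EFinP.
  - move=> w _; apply: ge0_le_integral => //.
    + by apply: measurableT_comp => //; apply/measurable_EFinP; exact: mFw.
    + by apply/measurable_EFinP; apply: measurable_funM.
    + by move=> s _; rewrite /= lee_fin F_le.
have -> : (\int[P]_w c = c)%E.
  by have := integral_cst P (@measurableT _ Omega) c; rewrite /= probability_setT mule1.
by rewrite ltey_eq cfin.
Qed.

(** With W the inner products of the control with e_n, k the singular kernel and
    E the Mittag-Leffler factor, this is the real part of the n-th coefficient
    of the solution started from 0, as a random variable. *)
Definition averaged w := complex.Re (cintegral m1 I (fun s => W s * (k s)%:C * E w s)).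

(** W may be replaced by its bounded version V under the integral in time. *)
Let avgE w : (averaged w)%:E = (\int[m1]_s (F (w, s))%:E)%E.
Proof.
rewrite -(fineK (integrable_fin_num measurableT (iFw w))); congr EFin.
rewrite /averaged /cintegral/= -[RHS]/(\int[m1]_s F (w, s)).
rewrite [LHS]Rintegral_mkcond /Rintegral; congr fine; apply: ae_eq_integral => //.
- apply/measurable_EFinP/(measurable_restrictT _ mI)/measurable_funTS.
  have Ew : cmeasurable_fun setT (E w).
    by have [E1 E2] := mE; split; [exact: (measurable_fun_pair2 w E1)|exact: (measurable_fun_pair2 w E2)].
  have kc : cmeasurable_fun setT (fun s => (k s)%:C) by split => //; exact: measurable_cst.
  by have [] := cmeasurable_funM (cmeasurable_funM mW kc) Ew.
- by apply/measurable_EFinP; exact: mFw.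
- have [N [mN N0 sub]] := WV; exists N; split => // s /= h; apply: sub => /= WVs; apply: h => _.
  congr EFin; rewrite patchE /F/= indicE WVs.
  case: ifPn => _; last by rewrite !mul0r.
  by rewrite !Re_mulc Im_mulc/= !mulr0; ring.
Qed.

Lemma integrable_averaged : P.-integrable setT (EFin \o averaged).
Proof.
apply: eq_integrable (integrable_fubini_F iF) => // w _.
by rewrite /= avgE.
Qed.

(** By Fubini's theorem only the mean of E over w survives under the integral in
    time, and V is bounded by K. *)
Lemma averaged_le : `|\int[P]_w averaged w| <=
  \int[m1]_(s in I) (2 * K * (k s * normc (cintegral P setT (E^~ s)))).
Proof.
have [E1 E2] := mE.
have E1s s : measurable_fun setT (fun w => complex.Re (E w s)) by exact: (measurable_fun_pair1 s E1).
have E2s s : measurable_fun setT (fun w => complex.Im (E w s)) by exact: (measurable_fun_pair1 s E2).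
have ci s : cintegrable P setT (E^~ s).
  by apply: (@bounded_cintegrable _ _ _ P _ B) => [|w]; [split; [exact: E1s|exact: E2s]|exact: EB].
pose Phi s := cintegral P setT (E^~ s).
pose H s := \1_I s * k s * (complex.Re (V s) * complex.Re (Phi s) - complex.Im (V s) * complex.Im (Phi s)).
have PhiB s : normc (Phi s) <= 2 * B.
  by apply: normc_expectation_le => [|w]; [split; [exact: E1s|exact: E2s]|exact: EB].
have mPhi : cmeasurable_fun setT Phi.
  have msw : measurable_fun setT (fun z : R * Omega => (z.2, z.1)) by exact: measurable_swap.
  split.
  - exact: (measurable_Rintegral_section P (measurableT_comp E1 msw)).
  - exact: (measurable_Rintegral_section P (measurableT_comp E2 msw)).
have step : \int[P]_w averaged w = \int[m1]_s H s.
  rewrite /Rintegral; congr fine.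
  transitivity (\int[P]_w \int[m1]_s (EFin \o F) (w, s))%E.
    by apply: eq_integral => w _; rewrite avgE.
  rewrite (Fubini iF); apply: eq_integral => s _.
  have [c1 c2] := ci s.
  have iZ (c : R) (f : Omega -> R) : P.-integrable setT (EFin \o f) ->
      P.-integrable setT (EFin \o (fun w => c * f w)).
    move=> fi; rewrite (_ : _ \o _ = (fun w => c%:E * (EFin \o f) w)%E)//.
    exact: integrableZl.
  have i1 := iZ (complex.Re (V s)) _ c1.
  have i2 := iZ (complex.Im (V s)) _ c2.
  have i12 : P.-integrable setT (EFin \o (fun w => complex.Re (V s) * complex.Re (E w s) -
      complex.Im (V s) * complex.Im (E w s))).
    rewrite (_ : _ \o _ = (EFin \o (fun w => complex.Re (V s) * complex.Re (E w s))%R) \-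
      (EFin \o (fun w => complex.Im (V s) * complex.Im (E w s))%R))%E//.
    exact: integrableB.
  rewrite /H /Phi /cintegral/= -!RintegralZl// -RintegralB// -RintegralZl//.
  rewrite /Rintegral fineK//; apply: (integrable_fin_num measurableT).
  exact: (iZ (\1_I s * k s) _ i12).
have mH : measurable_fun setT H.
  have [V1 V2] := mV; have [P1 P2] := mPhi.
  by apply: measurable_funM => //; apply: measurable_funB; exact: measurable_funM.
have H_le s : `|H s| <= 2 * K * (\1_I s * k s * normc (Phi s)).
  rewrite /H normrM (ger0_norm (ind0 s)) mulrCA ler_wpM2l ?ind0//.
  apply: le_trans (ler_normB _ _) _; rewrite !normrM -mulrA mulr_natl mulr2n.
  have [h1 h2] := VK s.
  by apply: lerD; apply: ler_pM => //; [exact: ler_Re_normc|exact: ler_Im_normc].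
have ib : m1.-integrable setT (EFin \o (fun s => 2 * K * (\1_I s * k s * normc (Phi s)))).
  apply: (le_integrable measurableT _ _ (igc (2 * K * (2 * B)))).
    apply/measurable_EFinP; apply: measurable_funM => //; apply: measurable_funM => //.
    exact: measurable_normc.
  have K2 : 0 <= 2 * K by rewrite mulr_ge0.
  move=> s _; rewrite /= lee_fin; apply: le_trans (ler_norm _).
  rewrite ger0_norm; last exact: (mulr_ge0 K2 (mulr_ge0 (ind0 s) (normc_ge0 (Phi s)))).
  have -> : 2 * K * (2 * B) * (\1_I s * k s) = 2 * K * (\1_I s * k s * (2 * B)) by ring.
  exact: (ler_wpM2l K2 (ler_wpM2l (ind0 s) (PhiB s))).
have -> : \int[m1]_(s in I) (2 * K * (k s * normc (cintegral P setT (E^~ s)))) =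
   \int[m1]_s (2 * K * (\1_I s * k s * normc (Phi s))).
  rewrite Rintegral_mkcond; apply: eq_Rintegral => s _; rewrite patchE indicE.
  by case: ifPn => _; rewrite ?mul1r ?mul0r ?mulr0.
rewrite step; apply: (normr_Rintegral_le measurableT _ ib) => [|s _]; last exact: H_le.
apply: (le_integrable measurableT _ _ ib); first exact/measurable_EFinP.
by move=> s _; rewrite /= lee_fin; apply: le_trans (H_le s) (ler_norm _).
Qed.

End averaging.

(** * High frequencies are not seen on average *)

Section vanishing.
Context {R : realType}.
Notation mu := (@lebesgue_measure R).

(** Dominated convergence: at a fixed s < T the argument of phi tends to -oo, and
    the integrands are dominated by a multiple of the integrable kernel. *)
Lemma Rintegral_kernel_vanish (alpha T c B : R) (phi : R -> R) (lam : nat -> R) :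
  0 < alpha < 1 -> 0 < T -> 0 <= c ->
  measurable_fun setT phi -> (forall s, 0 <= phi s <= B) ->
  phi s @[s --> -oo] --> 0 -> lam @ \oo --> +oo ->
  \int[mu]_(s in `]0, T[) (c * ((T - s) `^ (alpha - 1) * phi (- (lam n * (T - s) `^ alpha))))
    @[n --> \oo] --> 0.
Proof.
move=> ha T0 c0 mphi phiB phi0 lamy.
have B0 : 0 <= B by have /andP[] := phiB 0; exact: le_trans.
pose k (s : R) : R := (T - s) `^ (alpha - 1).
have ik : mu.-integrable `]0, T[ (EFin \o k) by exact: integrable_powR_kernel.
have mk : measurable_fun setT k by exact: (measurable_powR_kernel alpha T).
pose f (n : nat) (s : R) : R := c * (k s * phi (- (lam n * (T - s) `^ alpha))).
pose g (s : R) : R := c * B * k s.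
have ig : mu.-integrable `]0, T[ (EFin \o g).
  by rewrite (_ : _ \o _ = (fun s => (c * B)%:E * (EFin \o k) s)%E)//; exact: integrableZl.
have mf n : measurable_fun `]0, T[ (EFin \o f n).
  apply: measurable_funTS; apply/measurable_EFinP.
  apply: measurable_funM => //; apply: measurable_funM => //.
  apply: (measurableT_comp mphi); apply: measurableT_comp => //.
  apply: measurable_funM => //.
  apply: (@measurableT_comp _ _ _ _ _ _ (fun t => t `^ alpha)); first exact: measurable_powR.
  exact: measurable_funB.
have fg n s : `|f n s| <= g s.
  have /andP[p0 pB] := phiB (- (lam n * (T - s) `^ alpha)).
  have k0 : 0 <= k s by exact: powR_ge0.
  rewrite /f /g ger0_norm; last by rewrite mulr_ge0// mulr_ge0.
  by rewrite -mulrA ler_wpM2l// mulrC ler_wpM2r.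
have cvgf s : s \in `]0, T[ -> f n s @[n --> \oo] --> 0.
  rewrite in_itv/= => /andP[s0 sT].
  rewrite -[X in _ --> X](mulr0 c); apply: cvgMl_tmp.
  rewrite -[X in _ --> X](mulr0 (k s)); apply: cvgMl_tmp.
  apply: (@cvg_comp _ _ _ (fun n => - (lam n * (T - s) `^ alpha)) phi _ (ninfty_nbhs R)) => //.
  have p0 : 0 < (T - s) `^ alpha by rewrite powR_gt0// subr_gt0.
  apply/cvgrNyPle => A; move/cvgryPge: lamy => /(_ (- A / ((T - s) `^ alpha))).
  by apply: filterS => n; rewrite ler_pdivrMr// => h; rewrite lerNl.
have f0 : {ae mu, forall s, `]0, T[%classic s -> (EFin \o f n) s @[n --> \oo] --> (cst 0%E : R -> \bar R) s}.
  by apply: aeW => s sI; apply: cvg_EFin; [exact: nearW|exact: cvgf].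
have fge : {ae mu, forall s n, `]0, T[%classic s -> (`|(EFin \o f n) s| <= (EFin \o g) s)%E}.
  by apply: aeW => s n _; rewrite lee_fin.
have mI : measurable (`]0, T[%classic : set (measurableTypeR R)) by exact: measurable_itv.
have [_ _ h] := @dominated_convergence _ (measurableTypeR R) R mu `]0, T[%classic mI
  (fun n => EFin \o f n) (cst 0%E) (EFin \o g) mf (measurable_cst _) f0 ig fge.
rewrite integral0 in h.
exact: (fine_cvg h).
Qed.

End vanishing.

(** * Averaged coefficients of a controlled solution *)

Section averaged_solution.
Context {R : realType} {disp : measure_display} {Omega : measurableType disp}.
Variables (P : probability Omega R) (xi : Omega -> R).
Hypothesis mxi : measurable_fun setT xi.
Variable alpha : R.
Hypothesis ha : 0 < alpha < 1.

Let ml (x : R) : R[i] := mittag_leffler alpha alpha (0 +i* x).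

Let cm_comp {d : measure_display} {X : measurableType d} (g : X -> R) :
  measurable_fun setT g -> cmeasurable_fun setT (fun x => ml (g x)).
Proof.
move=> mg; have [m1 m2] := measurable_mittag_leffler _ ha.
by split; [exact: (measurableT_comp m1 mg)|exact: (measurableT_comp m2 mg)].
Qed.

Let phi (s : R) : R := normc (frac_char_fun P alpha alpha xi s).

Lemma frac_char_fun_bounds s : 0 <= phi s <= 2 * (Gamma alpha)^-1.
Proof.
rewrite normc_ge0/=; apply: normc_expectation_le => [|w].
  by apply: (@cm_comp _ _ (fun w => s * xi w)); exact: measurable_funM.
exact: normc_mittag_leffler_le.
Qed.

Lemma measurable_frac_char_fun : measurable_fun setT phi.
Proof.
have mz : measurable_fun setT (fun z : R * Omega => z.1 * xi z.2).
  by apply: measurable_funM; [exact: measurable_fst|exact: (measurableT_comp mxi measurable_snd)].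
have [c1 c2] := cm_comp mz.
apply: measurable_normc; split.
- exact: (measurable_Rintegral_section P c1).
- exact: (measurable_Rintegral_section P c2).
Qed.

Context {d : nat} (G G0 : set 'rV[R]_d).
Hypotheses (mG : measurable G) (mG0 : measurable G0) (G0G : G0 `<=` G).
Hypothesis finG : (lebesgue_rV G < +oo)%E.
Variables (T C : R) (lam : nat -> R) (e : nat -> 'rV[R]_d -> R[i]).
Hypotheses (T0 : 0 < T) (C0 : 0 <= C) (he : hilbert_basis G e).

Let M := 1 + fine (lebesgue_rV G).

Let e_norm n : L2norm G (e n) = 1%E.
Proof. by have [eL2 eo _] := he; apply: (L2norm_unit mG (eL2 n)); rewrite eo eqxx. Qed.

Let i1 : lebesgue_rV.-integrable G (EFin \o (fun=> 1 : R)).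
Proof.
apply/integrableP; split; first exact/measurable_EFinP.
by under eq_integral do rewrite /= normr1; rewrite integral_cst// mul1e.
Qed.

(** |e n| <= |e n|^2 + 1, and |e n|^2 has integral 1; the bound does not depend
    on n. *)
Let e_integrable n : lebesgue_rV.-integrable G (EFin \o (fun x => normc (e n x))) /\
  \int[lebesgue_rV]_(x in G) normc (e n x) <= M.
Proof.
have [eL2 eo _] := he; have [me ie2] := csqint_L2 (eL2 n).
have ib : lebesgue_rV.-integrable G (EFin \o (fun x => normc (e n x) ^+ 2 + 1)).
  exact: (integrableD mG ie2 i1).
have le x : normc (e n x) <= normc (e n x) ^+ 2 + 1.
  by have := sqr_ge0 (normc (e n x) - 1); have := normc_ge0 (e n x); nra.
have ie : lebesgue_rV.-integrable G (EFin \o (fun x => normc (e n x))).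
  apply: (le_integrable mG _ _ ib); first by apply/measurable_EFinP; exact: measurable_normc.
  move=> x _; rewrite /= lee_fin ger0_norm ?normc_ge0//.
  exact: le_trans (le x) (ler_norm _).
split => //; apply: le_trans (le_Rintegral mG ie ib (fun x _ => le x)) _.
rewrite RintegralD//; apply: lerD.
  rewrite -lee_fin /Rintegral fineK; last exact: (integrable_fin_num mG ie2).
  rewrite -cLnorm2_sqr -[cLnorm _ _ _ _]/(L2norm G (e n)) e_norm.
  by rewrite poweR_EFin powR1.
by rewrite Rintegral_cst// mul1r.
Qed.

(** The left-hand side is Re <e n, e n>, computed as the mean of the n-th
    coefficient of the solution; the right-hand side is the bound of
    averaged_le on that mean. *)
Lemma averaged_coef_le n u :
  cmeasurable_fun (`]0, T[ `*` G0) u -> (Linfnorm T G0 u <= C%:E)%E ->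
  (exists Y, (forall w, solution_at alpha G G0 lam e T (xi w) (fun=> 0) u (Y w)) /\
    is_expectation G P Y (e n)) ->
  1 <= \int[lebesgue_measure]_(s in `]0, T[)
    (2 * (C * M) * ((T - s) `^ (alpha - 1) * phi (- (lam n * (T - s) `^ alpha)))).
Proof.
move=> mes_u uC [Y [solY expY]].
have [eL2 eo _] := he.
have [ie eM] := e_integrable n.
have mI : measurable (`]0, T[%classic : set R) by exact: measurable_itv.
have [W [V [mW mV innW WV VK]]] :=
  @cutoff_section R _ _ lebesgue_rV `]0, T[%classic G G0 u (e n) C mI mG mG0 G0G C0 mes_u (eL2 n).1 ie uC.
pose k (s : R) : R := (T - s) `^ (alpha - 1).
pose E w s := ml (- (xi w * lam n * (T - s) `^ alpha)).
have mE : cmeasurable_fun setT (fun z : Omega * R => E z.1 z.2).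
  apply: (@cm_comp _ _ (fun z : Omega * R => - (xi z.1 * lam n * (T - z.2) `^ alpha))).
  apply: measurableT_comp => //; apply: measurable_funM.
    by apply: measurable_funM => //; exact: (measurableT_comp mxi measurable_fst).
  apply: (@measurableT_comp _ _ _ _ _ _ (fun t => t `^ alpha)); first exact: measurable_powR.
  by apply: measurable_funB => //; exact: measurable_snd.
have EB w s : normc (E w s) <= (Gamma alpha)^-1 by exact: normc_mittag_leffler_le.
have mk : measurable_fun setT k by exact: (measurable_powR_kernel alpha T).
have k0 s : 0 <= k s by exact: powR_ge0.
have ik := integrable_powR_kernel ha T0.
have VK' s : `|complex.Re (V s)| <= C * M /\ `|complex.Im (V s)| <= C * M.
  by have [h1 h2] := VK s; split; [apply: le_trans h1 _|apply: le_trans h2 _]; rewrite ler_wpM2l.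
have iA := integrable_averaged P mI mk k0 ik mW mV WV VK' mE EB.
have A_le := averaged_le P mI mk k0 ik mW mV WV VK' mE EB.
have rE w : averaged `]0, T[%classic k W E w = complex.Re (inner G (Y w) (e n)).
  have [YL2 Ycvg] := solY w.
  rewrite (Re_inner_L2cvg mG n he YL2 Ycvg) /solution_coef.
  rewrite -[inner G (fun=> 0) (e n)]/(cinner lebesgue_rV G (fun=> 0) (e n)) cinner0 mul0r add0r.
  rewrite /averaged /cintegral/=; apply: eq_Rintegral => s; rewrite inE => sI.
  by rewrite -(innW s sI).
have := Re_inner_expectation mG (fun w => (solY w).1) (eL2 n) (eL2 n) (e_norm n) rE iA expY.
rewrite eo eqxx /= => e1; rewrite [leLHS]e1.
apply: le_trans (ler_norm _) _; apply: le_trans A_le _.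
rewrite le_eqVlt; apply/orP; left; apply/eqP; apply: eq_Rintegral => s _.
have -> : E^~ s = (fun w => ml (- (lam n * (T - s) `^ alpha) * xi w)).
  by apply/funext => w; rewrite /E; congr ml; ring.
by [].
Qed.

End averaged_solution.

Local Close Scope complex_scope.
Unset Implicit Arguments.

Theorem theorem4p1 (R : realType) (alpha T : R)
    (halpha : 0 < alpha < 1) (hT : 0 < T)
    (disp : measure_display) (Omega : measurableType disp)
    (P : probability Omega R) (xi : {RV P >-> R})
    (hxi_pinfty : normc (frac_char_fun P alpha alpha xi s) @[s --> +oo] --> 0)
    (hxi_ninfty : normc (frac_char_fun P alpha alpha xi s) @[s --> -oo] --> 0)
    (d : nat) (hd : (0 < d)%N)
    (G : set 'rV[R]_d) (hG : lipschitz_domain G) (hGb : bounded_set G)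
    (G0 : set 'rV[R]_d) (hG0 : measurable G0) (hG0G : G0 `<=` G)
    (hG0_pos : (0 < lebesgue_rV G0)%E)
    (lam : nat -> R) (e : nat -> 'rV[R]_d -> R[i])
    (hbasis : dirichlet_eigenbasis G lam e) :
  ~ exactly_averaged_controllable alpha T G G0 lam e P xi.
Proof.
move=> [C C0 hC].
have [oG _ _ _] := hG; have mG := open_measurable_rV _ oG.
have finG := bounded_lebesgue_rV _ hGb.
have [_ _ lamy _ he] := hbasis; have [eL2 eo _] := he.
have mxi : measurable_fun setT xi by exact: measurable_funPT.
pose phi s := normc (frac_char_fun P alpha alpha xi s).
pose J n := \int[lebesgue_measure]_(s in `]0, T[)
  (2 * (C * (1 + fine (lebesgue_rV G))) *
     ((T - s) `^ (alpha - 1) * phi (- (lam n * (T - s) `^ alpha)))).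
have J1 n : 1 <= J n.
  have zL2 : in_L2 G (fun=> 0) by apply: csqint_in_L2 => //; exact: csqint0.
  have [u [mes_u uC hY]] := hC _ _ zL2 (eL2 n).
  apply: (averaged_coef_le mxi halpha mG hG0 hG0G finG hT (ltW C0) he mes_u _ hY).
  apply: le_trans uC _.
  have -> : L2norm G (fun=> 0) = 0%E.
    rewrite /L2norm /cLnorm -[RHS](@Lnorm0 _ _ _ (@lebesgue_rV R d) 2%:E)//; apply: eq_Lnorm => x.
    by rewrite patchE normc0; case: ifP.
  by rewrite (L2norm_unit mG (eL2 n)) ?eo ?eqxx// add0e mule1.
have J0 : J n @[n --> \oo] --> 0.
  apply: (@Rintegral_kernel_vanish _ alpha T _ (2 * (Gamma alpha)^-1) phi lam) => //.
  - by rewrite !mulr_ge0// ?(ltW C0)// addr_ge0// fine_ge0.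
  - exact: measurable_frac_char_fun.
  - by move=> s; exact: frac_char_fun_bounds.
have : limn J >= 1 by apply: limr_ge; [exact: cvgP J0|exact: nearW].
by rewrite (cvg_lim _ J0)// ler10.
Qed.
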